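(* Let $K:\mathbb B_d\times\mathbb B_d\to\mathcal M_d(\mathbb C)$ be a non-negative definite kernel of the form $$K(\boldsymbol z,\boldsymbol w)=\sum_{\ell=1}^\infty(\tilde a_{\ell,1}-\tilde a_{\ell,2})\langle\boldsymbol z,\boldsymbol w\rangle^{\ell-1}\boldsymbol z\bar{\boldsymbol w}^\dagger+\sum_{\ell=0}^\infty\tilde a_{\ell,2}\langle\boldsymbol z,\boldsymbol w\rangle^\ell I_d,$$ with complex numbers $\tilde a_{\ell,1}$ ($\ell\ge1$), $\tilde a_{\ell,2}$ ($\ell\ge0$), and set $\tilde a_{0,1}:=\tilde a_{0,2}$. Then the $d$-tuple $\boldsymbol M$ of multiplication by the coordinate functions on $\mathcal H_K(\mathbb B_d,\mathbb C^d)$ is bounded if and only if $$\sup_{\ell\ge1}\Big\{\frac{(\ell+d-1)\tilde a_{\ell-1,1}-(d-1)\tilde a_{\ell-1,2}}{(\ell+d-1)\tilde a_{\ell,1}-(d-1)\tilde a_{\ell,2}},\ \frac{\tilde a_{\ell-1,2}}{\tilde a_{\ell,2}}\Big\}<\infty.$$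
   Context: $\mathbb B_d$ is the unit ball of $\mathbb C^d$, $\langle\boldsymbol z,\boldsymbol w\rangle=\sum_iz_i\bar w_i$, and $\boldsymbol z\bar{\boldsymbol w}^\dagger$ is the $d\times d$ matrix with $(i,j)$ entry $z_i\bar w_j$. $\mathcal H_K(\mathbb B_d,\mathbb C^d)$ is the reproducing kernel Hilbert space of $\mathbb C^d$-valued holomorphic functions with kernel $K$.
   Formalization: The dimension is assumed to be d ≥ 2 (for d = 1 the coefficients ã_{ℓ,2}, ℓ ≥ 1, do not occur in K and the claim fails, e.g. Hardy kernel with ã_{ℓ,2} = 2^{-ℓ²}), and all denominators in the two ratios are assumed nonzero. *)

(* Defs.v *)
From HB Require Import structures.
From mathcomp Require Import all_boot all_order all_algebra.
From mathcomp Require Import complex.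
From mathcomp Require Import reals.
Set Implicit Arguments. Unset Strict Implicit. Unset Printing Implicit Defensive.
Import Order.TTheory GRing.Theory Num.Theory.
Local Open Scope ring_scope.
Local Open Scope complex_scope.

Section Defs.
Variables (R : realType) (d : nat).
Local Notation C := R[i].

(* modulus of a complex number, real valued *)
Definition cabs (x : C) : R := Num.sqrt (complex.Re x ^+ 2 + complex.Im x ^+ 2).

(* elementary convergence of a complex sequence *)
Definition ccvg (u : nat -> C) (l : C) : Prop :=
  forall e : R, 0 < e -> exists N : nat, forall n, (N <= n)%N -> cabs (u n - l) < e.

(* the series sum_{l>=0} u l of d x d matrices converges entrywise to L *)
Definition mxseries_to (u : nat -> 'M[C]_d) (L : 'M[C]_d) : Prop :=
  forall i j, ccvg (fun N => \sum_(l < N) u l i j) (L i j).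

(* points of C^d and C^d-valued vectors are column vectors *)
Definition cinner (z w : 'cV[C]_d) : C := \sum_i z i 0 * (w i 0)^*.

(* the open unit ball B_d *)
Definition inBall (z : 'cV[C]_d) : bool := cinner z z < 1.

(* z \bar w^dagger : the matrix with (i,j) entry z_i \bar w_j *)
Definition zwdag (z w : 'cV[C]_d) : 'M[C]_d := \matrix_(i, j) (z i 0 * (w j 0)^*).

(* non-negative definite M_d(C)-valued kernel on B_d *)
Definition nonneg_kernel (K : 'cV[C]_d -> 'cV[C]_d -> 'M[C]_d) : Prop :=
  forall (n : nat) (pts vs : 'I_n -> 'cV[C]_d), (forall k, inBall (pts k)) ->
    0 <= \sum_(k < n) \sum_(l < n) cinner (K (pts k) (pts l) *m vs l) (vs k).

(* The reproducing kernel Hilbert space H_K(B_d, C^d) (Moore-Aronszajn)*)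
(* A function B_d -> C^d is represented by a map 'cV_d -> 'cV_d; only *)
(* its values on B_d matter.                                          *)
(* An element of the linear span of {K(.,w) v : w in B_d, v in C^d}  *)
(* is represented by a finite list s of pairs (w, v):                 *)
(*   kfun K s = sum_{(w,v) in s} K(., w) v                            *)
Definition kfun (K : 'cV[C]_d -> 'cV[C]_d -> 'M[C]_d) (s : seq ('cV[C]_d * 'cV[C]_d))
  : 'cV[C]_d -> 'cV[C]_d :=
  fun z => \sum_(p <- s) K z p.1 *m p.2.

(* squared norm  < kfun s, kfun s >, with <K(.,w)v, K(.,w')v'> = <K(w',w)v, v'> *)
Definition knorm2 (K : 'cV[C]_d -> 'cV[C]_d -> 'M[C]_d) (s : seq ('cV[C]_d * 'cV[C]_d)) : C :=
  \sum_(p <- s) \sum_(q <- s) cinner (K q.1 p.1 *m p.2) q.2.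

(* representation of the difference kfun s1 - kfun s2 *)
Definition kdiff (s1 s2 : seq ('cV[C]_d * 'cV[C]_d)) : seq ('cV[C]_d * 'cV[C]_d) :=
  s1 ++ [seq (p.1, - p.2) | p <- s2].

Definition ball_list (s : seq ('cV[C]_d * 'cV[C]_d)) : bool := all (fun p => inBall p.1) s.

(* f belongs to H_K and ||f||_{H_K} <= c : f is the pointwise limit on B_d of a
   Cauchy sequence (for the H_K norm) of elements of the span whose norms have
   limit (at most) c *)
Definition HK_le (K : 'cV[C]_d -> 'cV[C]_d -> 'M[C]_d) (f : 'cV[C]_d -> 'cV[C]_d) (c : R)
  : Prop :=
  0 <= c /\
  exists s : nat -> seq ('cV[C]_d * 'cV[C]_d),
    (forall n, ball_list (s n)) /\
    (forall e : R, 0 < e -> exists N : nat, forall m n, (N <= m)%N -> (N <= n)%N ->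
        knorm2 K (kdiff (s m) (s n)) < e%:C) /\
    (forall z, inBall z -> forall i, ccvg (fun n => kfun K (s n) z i 0) (f z i 0)) /\
    (forall e : R, 0 < e -> exists N : nat, forall n, (N <= n)%N ->
        knorm2 K (s n) < (c ^+ 2 + e)%:C).

(* multiplication by the coordinate function z_i *)
Definition mulz (i : 'I_d) (f : 'cV[C]_d -> 'cV[C]_d) : 'cV[C]_d -> 'cV[C]_d :=
  fun z => z i 0 *: f z.

(* M_{z_i} is a bounded operator on H_K: it maps H_K into H_K and
   ||z_i f|| <= B ||f|| for all f in H_K *)
Definition mult_bounded (K : 'cV[C]_d -> 'cV[C]_d -> 'M[C]_d) (i : 'I_d) : Prop :=
  exists B : R, forall f c, HK_le K f c -> HK_le K (mulz i f) (B * c).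

(* the d-tuple M = (M_{z_1}, ..., M_{z_d}) is bounded *)
Definition tuple_bounded (K : 'cV[C]_d -> 'cV[C]_d -> 'M[C]_d) : Prop :=
  forall i : 'I_d, mult_bounded K i.

(* the two series in the kernel; a1, a2 : nat -> C, a1 0 unused *)
Definition kterm1 (a1 a2 : nat -> C) (z w : 'cV[C]_d) (l : nat) : 'M[C]_d :=
  (* term of index l.+1 of  sum_{l>=1} (a1 l - a2 l) <z,w>^(l-1) z wbar^dagger *)
  ((a1 l.+1 - a2 l.+1) * cinner z w ^+ l) *: zwdag z w.

Definition kterm2 (a2 : nat -> C) (z w : 'cV[C]_d) (l : nat) : 'M[C]_d :=
  (* term of index l of  sum_{l>=0} a2 l <z,w>^l I_d *)
  (a2 l * cinner z w ^+ l) *: 1%:M.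

(* convention \tilde a_{0,1} := \tilde a_{0,2} *)
Definition a1ext (a1 a2 : nat -> C) (l : nat) : C := if l is 0 then a2 0%N else a1 l.

Definition denom1 (a1 a2 : nat -> C) (l : nat) : C :=
  (l + d - 1)%:R * a1ext a1 a2 l - (d - 1)%:R * a2 l.

End Defs.

(* numerator of the first ratio: (l+d-1) a~_{l-1,1} - (d-1) a~_{l-1,2} *)
Definition num1 (d : nat) (R : realType) (a1 a2 : nat -> R[i]) (l : nat) : R[i] :=
  (l + d - 1)%:R * a1ext a1 a2 l.-1 - (d - 1)%:R * a2 l.-1.

(* Main.v *)
(* Boundedness of the tuple means that [(c - <z,w>) K] is non-negative definite for some c:
   the adjoint of multiplication by [z_i] sends [K(., w) v] to [conj w_i . K(., w) v], and a
   function [f] lies in [H_K] with norm at most c exactly when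
   [|sum <f(w), v>| <= c ||sum K(., w) v||] (Riesz).  Both [K] and [(c - <z,w>) K] are sums over
   l of [a_l <z,w>^(l-1) z w^dagger + b_l <z,w>^l I].  The degree l part acts on the
   homogeneous polynomial maps of degree l, which split as the multiples of z plus the
   divergence free maps, with the eigenvalues [((l+d-1) a_l + l b_l) / l] and [b_l] relative to
   [<z,w>^l I].  Such a sum is therefore non-negative definite if and only if all these
   numbers are non-negative, and for [(c - <z,w>) K] this says that the two ratios are at
   most c. *)
Require Import Defs.
From HB Require Import structures.
From mathcomp Require Import all_boot all_order all_algebra.
From mathcomp Require Import perm complex.
From mathcomp Require Import boolp classical_sets reals.
From mathcomp Require Import zify ring lra.
Import Order.TTheory GRing.Theory Num.Theory.
Local Open Scope ring_scope.
Local Open Scope complex_scope.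
Set Implicit Arguments. Unset Strict Implicit. Unset Printing Implicit Defensive.

(** * Convergence of complex sequences *)

Section Limits.
Variable R : realType.
Local Notation C := R[i].
Implicit Types (u v : nat -> C) (l x y : C).

Lemma normc_cabs x : `|x| = (cabs x)%:C.
Proof. exact: normc_def. Qed.

Lemma ccvgP u l :
  ccvg u l <->
  forall e : C, 0 < e -> exists N : nat, forall n, (N <= n)%N -> `|u n - l| < e.
Proof.
split=> h e e0.
  have /andP[/eqP /= Ime Ree] : (complex.Im e == 0) && (0 < complex.Re e).
    by move: e0; rewrite ltcE.
  have [N hN] := h _ Ree; exists N => n /hN.
  by rewrite normc_cabs ltcE /= Ime eqxx.
have e0' : 0 < e%:C by rewrite (ltcR 0).
by have [N hN] := h _ e0'; exists N => n /hN; rewrite normc_cabs ltcR.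
Qed.

Lemma ccvg_ext u v l : u =1 v -> ccvg u l -> ccvg v l.
Proof. by move=> uv h e /h[N hN]; exists N => n /hN; rewrite uv. Qed.

Lemma ccvg_cst l : ccvg (fun=> l) l.
Proof. by apply/ccvgP => e e0; exists 0%N => n _; rewrite subrr normr0. Qed.

Lemma ccvgD u v l m : ccvg u l -> ccvg v m -> ccvg (fun n => u n + v n) (l + m).
Proof.
move=> /ccvgP hu /ccvgP hv; apply/ccvgP => e e0.
have e2 : 0 < e / 2 by rewrite divr_gt0.
have [N hN] := hu _ e2; have [M hM] := hv _ e2.
exists (maxn N M) => n; rewrite geq_max => /andP[/hN h1 /hM h2].
rewrite opprD addrACA; apply: le_lt_trans (ler_normD _ _) _.
by rewrite [e]splitr ltrD.
Qed.

Lemma ccvgM a u l : ccvg u l -> ccvg (fun n => a * u n) (a * l).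
Proof.
move=> /ccvgP hu; apply/ccvgP => e e0.
have a1 : 0 < `|a| + 1 by rewrite ltr_wpDl.
have [|N hN] := hu (e / (`|a| + 1)); first by rewrite divr_gt0.
exists N => n /hN h; rewrite -mulrBr normrM.
apply: (@le_lt_trans _ _ ((`|a| + 1) * `|u n - l|)).
  by rewrite ler_wpM2r // lerDl.
by rewrite mulrC -ltr_pdivlMr.
Qed.

Lemma ccvg_sum (I : Type) (r : seq I) (P : pred I) (u : I -> nat -> C) (l : I -> C) :
  (forall i, P i -> ccvg (u i) (l i)) ->
  ccvg (fun n => \sum_(i <- r | P i) u i n) (\sum_(i <- r | P i) l i).
Proof.
move=> h; elim: r => [|i r ih].
  by rewrite big_nil; apply: ccvg_ext (ccvg_cst 0) => n; rewrite big_nil.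
rewrite big_cons; case: ifP => Pi.
  by apply: ccvg_ext (ccvgD (h i Pi) ih) => n; rewrite big_cons Pi.
by apply: ccvg_ext ih => n; rewrite big_cons Pi.
Qed.

Lemma ccvg_shift u l : ccvg u l -> ccvg (fun n => u n.+1) l.
Proof. by move=> h e /h[N hN]; exists N => n Nn; apply: hN; rewrite leqW. Qed.

Lemma ccvg_unshift u l : ccvg (fun n => u n.+1) l -> ccvg u l.
Proof. by move=> h e /h[N hN]; exists N.+1 => -[//|n] Nn; apply: hN. Qed.

(** On [C] the claim includes that [x] is real, so it is proved as [|x| = x]: the gap [|x| - x] is
    at most twice the distance from [x] to any [y >= 0]. *)
Lemma ge0_approx x : (forall e, 0 < e -> exists2 y, 0 <= y & `|y - x| <= e) -> 0 <= x.
Proof.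
move=> h; suff : `|x| - x == 0 by rewrite subr_eq0 => /eqP <-.
rewrite -normr_le0 real_leNgt ?rpred0 ?normr_real //; apply/negP => z0.
have [|y y0 hy] := h (`| `|x| - x| / 3); first by rewrite divr_gt0.
have : `| `|x| - x| <= `|y - x| + `|y - x|.
  rewrite (_ : `|x| - x = (`|x| - `|y|) + (y - x)); last first.
    by rewrite (ger0_norm y0) addrA subrK.
  apply: le_trans (ler_normD _ _) _; rewrite lerD2r.
  by apply: le_trans (ler_dist_dist _ _) _; rewrite distrC.
move=> /le_trans/(_ (lerD hy hy)).
rewrite -mulrDr ler_pMr // -mulr2n -[_ *+ 2]mulr_natr mulrC ler_pdivlMr ?ltr0n //.
by rewrite mul1r ler_nat.
Qed.

Lemma ccvg_ge0 u l : ccvg u l -> (forall n, 0 <= u n) -> 0 <= l.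
Proof.
move=> /ccvgP hu u0; apply: ge0_approx => e /hu[N hN].
by exists (u N) => //; apply/ltW/hN.
Qed.

Lemma ccvg_bounded u l : ccvg u l -> exists M : C, forall n, `|u n| <= M.
Proof.
move=> /ccvgP /(_ 1 ltr01)[N hN].
exists (`|l| + 1 + \sum_(i < N) `|u i|) => n.
have s0 : 0 <= \sum_(i < N) `|u i| by rewrite sumr_ge0.
case: (ltnP n N) => [nN|/hN Nn].
  rewrite (bigD1 (Ordinal nN)) //= addrCA lerDl addr_ge0 ?addr_ge0 ?sumr_ge0 //.
rewrite -[`|u n|]addr0; apply: lerD => //.
rewrite -[u n](subrK l) addrC; apply: le_trans (ler_normD _ _) _.
by rewrite lerD2l; apply/ltW.
Qed.

Lemma inv_succ_small (e : R) : 0 < e ->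
  exists N : nat, forall n, (N <= n)%N -> n.+1%:R^-1 < e.
Proof.
move=> e0; exists (Num.bound e^-1) => n Nn.
rewrite -[e]invrK ltf_pV2 ?posrE ?invr_gt0 ?ltr0n //.
apply: (@lt_le_trans _ _ (Num.bound e^-1)%:R).
  by apply: archi_boundP; rewrite invr_ge0 ltW.
by rewrite ler_nat leqW.
Qed.

Lemma ccvg_norm_sqr_le u l (b : R) : ccvg u l ->
    (forall e : R, 0 < e -> exists N : nat, forall n, (N <= n)%N ->
      `|u n| ^+ 2 <= (b + e)%:C) ->
  `|l| ^+ 2 <= b%:C.
Proof.
move=> /ccvgP hu ub; rewrite -subr_ge0; apply: ge0_approx => e e0.
have [e' ee'] : exists e', e = e'%:C.
  by exists (complex.Re e); rewrite RRe_real // ger0_real ?ltW.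
have e'0 : 0 < e' by rewrite -(ltcR 0) -ee'.
have l1 : 0 < 2 * `|l| + 1 by rewrite ltr_wpDl ?mulr_ge0.
have [|N hN] := ub (e' / 2); first by rewrite divr_gt0.
have [|M hM] := hu 1; first exact: ltr01.
(* The difference of squares factors, and [2 * |l| + 1] bounds [|l| + |u n|] once
   [|u n - l| < 1]. *)
have [|P hP] := hu (e / 2 / (2 * `|l| + 1)); first by rewrite !divr_gt0.
pose n := maxn N (maxn M P).
have /hN h1 : (N <= n)%N by rewrite leq_maxl.
have /hM h2 : (M <= n)%N by rewrite leq_max leq_maxl orbT.
have /hP h3 : (P <= n)%N by rewrite leq_max leq_maxr orbT.
exists ((b + e' / 2)%:C - `|u n| ^+ 2); first by rewrite subr_ge0.
rewrite (_ : _ - _ - _ = (e' / 2)%:C + (`|l| - `|u n|) * (`|l| + `|u n|)); last first.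
  by rewrite rmorphD /=; ring.
apply: le_trans (ler_normD _ _) _.
rewrite [leRHS]splitr; apply: lerD.
  by rewrite ee' ger0_norm ?ler0c ?divr_ge0 // ?(ltW e'0) // rmorphM fmorphV rmorph_nat.
rewrite normrM -[leRHS](divfK (lt0r_neq0 l1)); apply: ler_pM => //.
  by apply: le_trans (ler_dist_dist _ _) _; rewrite distrC ltW.
rewrite ger0_norm ?addr_ge0 // mulr_natl mulr2n -addrA lerD2l.
rewrite -[X in `|X|](subrKC l); apply: le_trans (ler_normD _ _) _.
by rewrite lerD2l ltW.
Qed.
End Limits.

(** * The kernel form and the Riesz representation *)

Section Inner.
Local Open Scope ring_scope.
Variables (R : realType) (d : nat).
Local Notation C := R[i].
Local Notation V := 'cV[C]_d.
Implicit Types (z w v : V) (a : C).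

(* The generic [rmorph] lemmas would turn [Num.conj] into [conjc]. *)
Lemma conjCD (x y : C) : (x + y)^* = x^* + y^*.
Proof. exact: rmorphD. Qed.

Lemma conjCM (x y : C) : (x * y)^* = x^* * y^*.
Proof. exact: rmorphM. Qed.

Lemma conjC_sum (I : Type) (r : seq I) (P : pred I) (F : I -> C) :
  (\sum_(i <- r | P i) F i)^* = \sum_(i <- r | P i) (F i)^*.
Proof. exact: rmorph_sum. Qed.

Lemma conj_realC (x : R) : (x%:C)^* = x%:C.
Proof. exact: (conjc_real x). Qed.

Lemma cinnerDl v w z : cinner (v + w) z = cinner v z + cinner w z.
Proof. by rewrite -big_split /=; apply: eq_bigr => i _; rewrite mxE mulrDl. Qed.

Lemma cinnerZl a v z : cinner (a *: v) z = a * cinner v z.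
Proof. by rewrite mulr_sumr; apply: eq_bigr => i _; rewrite mxE mulrA. Qed.

Lemma cinner_conj v w : (cinner v w)^* = cinner w v.
Proof.
rewrite conjC_sum; apply: eq_bigr => i _.
by rewrite conjCM conjCK mulrC.
Qed.

Lemma cinnerDr v w z : cinner z (v + w) = cinner z v + cinner z w.
Proof. by rewrite -cinner_conj cinnerDl conjCD !cinner_conj. Qed.

Lemma cinnerZr a v z : cinner z (a *: v) = a^* * cinner z v.
Proof. by rewrite -cinner_conj cinnerZl conjCM !cinner_conj. Qed.

Lemma cinner0l z : cinner 0 z = 0.
Proof. by rewrite -(scale0r 0) cinnerZl mul0r. Qed.

Lemma cinner_suml (I : Type) (r : seq I) (P : pred I) (F : I -> V) z :
  cinner (\sum_(i <- r | P i) F i) z = \sum_(i <- r | P i) cinner (F i) z.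
Proof.
by apply: (big_morph (fun v => cinner v z)) => [v w|];
  [apply: cinnerDl | apply: cinner0l].
Qed.

Lemma cinner_delta z i : cinner z (delta_mx i 0) = z i 0.
Proof.
rewrite /cinner (bigD1 i) //= mxE !eqxx rmorph_nat mulr1 big1 ?addr0 // => j ji.
by rewrite mxE (negbTE ji) rmorph_nat mulr0.
Qed.
End Inner.

Section Form.
Local Open Scope ring_scope.
Variables (R : realType) (d : nat).
Local Notation C := R[i].
Local Notation V := 'cV[C]_d.
Variable K : V -> V -> 'M[C]_d.
Implicit Types (s t u : seq (V * V)) (f : V -> V) (z w v : V) (a : C).

(** By the reproducing property this is the inner product of [f] with [kfun K t] when [f] lies in
    [H_K]. *)
Definition pairing f t : C := \sum_(q <- t) cinner (f q.1) q.2.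

Definition kform s t : C := pairing (kfun K s) t.

Definition lscale a t : seq (V * V) := [seq (p.1, a *: p.2) | p <- t].

Lemma pairing_cat f s t : pairing f (s ++ t) = pairing f s + pairing f t.
Proof. exact: big_cat. Qed.

Lemma pairing_lscale f a t : pairing f (lscale a t) = a^* * pairing f t.
Proof.
by rewrite /pairing big_map mulr_sumr; apply: eq_bigr => p _; rewrite cinnerZr.
Qed.

Lemma pairing1 f z v : pairing f [:: (z, v)] = cinner (f z) v.
Proof. exact: big_seq1. Qed.

Lemma kfun_cat s t z : kfun K (s ++ t) z = kfun K s z + kfun K t z.
Proof. exact: big_cat. Qed.

Lemma kfun_lscale a t z : kfun K (lscale a t) z = a *: kfun K t z.
Proof.
by rewrite /kfun big_map scaler_sumr; apply: eq_bigr => p _; rewrite -scalemxAr.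
Qed.

Lemma kform_catr s t u : kform s (t ++ u) = kform s t + kform s u.
Proof. exact: pairing_cat. Qed.

Lemma kform_catl s t u : kform (s ++ t) u = kform s u + kform t u.
Proof.
by rewrite -big_split /=; apply: eq_bigr => q _; rewrite kfun_cat cinnerDl.
Qed.

Lemma kform_lscaler a s t : kform s (lscale a t) = a^* * kform s t.
Proof. exact: pairing_lscale. Qed.

Lemma kform_lscalel a s t : kform (lscale a s) t = a * kform s t.
Proof.
by rewrite mulr_sumr; apply: eq_bigr => q _; rewrite kfun_lscale cinnerZl.
Qed.

Lemma knorm2E s : knorm2 K s = kform s s.
Proof.
rewrite /knorm2 exchange_big; apply: eq_bigr => q _.
by rewrite cinner_suml.
Qed.

Lemma kdiffE s t : kdiff s t = s ++ lscale (-1) t.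
Proof. by congr (_ ++ _); apply: eq_map => p; rewrite scaleN1r. Qed.

Lemma ball_list_cat s t : ball_list (s ++ t) = ball_list s && ball_list t.
Proof. exact: all_cat. Qed.

Lemma ball_list_lscale a t : ball_list (lscale a t) = ball_list t.
Proof. by rewrite /ball_list all_map. Qed.

Lemma pairing_cvg (fn : nat -> V -> V) f t : ball_list t ->
    (forall z, inBall z -> forall i, ccvg (fun n => fn n z i 0) (f z i 0)) ->
  ccvg (fun n => pairing (fn n) t) (pairing f t).
Proof.
move=> bt h; elim: t bt => [_|q t ih /= /andP[bq bt]].
  by apply: ccvg_ext (ccvg_cst _) => n; rewrite /pairing !big_nil.
have H : ccvg (fun n => cinner (fn n q.1) q.2) (cinner (f q.1) q.2).
  apply: ccvg_sum => i _; rewrite mulrC.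
  by apply: ccvg_ext (ccvgM _ (h _ bq i)) => n; rewrite mulrC.
rewrite /pairing big_cons; apply: ccvg_ext (ccvgD H (ih bt)) => n.
by rewrite /pairing big_cons.
Qed.

Lemma nonneg_kformP :
  nonneg_kernel K <-> forall s, ball_list s -> 0 <= kform s s.
Proof.
split=> [hK s bs|hK n pts vs bp].
  rewrite -knorm2E /knorm2 exchange_big /=.
  pose x0 := ((0, 0) : V * V).
  have := hK (size s) (fun k => (nth x0 s k).1) (fun k => (nth x0 s k).2).
  move=> /(_ _)/le_trans; apply=> [k|].
    by apply: (allP bs (nth x0 s k)); rewrite mem_nth.
  rewrite (big_nth x0) big_mkord le_eqVlt; apply/orP/or_introl/eqP.
  by apply: eq_bigr => k _; rewrite (big_nth x0) big_mkord.
have := hK [seq (pts k, vs k) | k <- index_enum 'I_n].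
rewrite -knorm2E /knorm2 exchange_big /= big_map.
move=> /(_ _)/le_trans; apply.
  by rewrite /ball_list all_map; apply/allP => k _; apply: bp.
rewrite le_eqVlt; apply/orP/or_introl/eqP.
by apply: eq_bigr => k _; rewrite big_map.
Qed.

Hypothesis K_ge0 : nonneg_kernel K.

Lemma kform_ge0 s : ball_list s -> 0 <= kform s s.
Proof. exact: (nonneg_kformP.1 K_ge0). Qed.

(** Polarisation: the form at [s ++ lscale a t] is real for every [a], and [a = 1], [a = 'i] compare
    the imaginary and real parts of the two cross terms. *)
Lemma kform_conj s t : ball_list s -> ball_list t -> (kform s t)^* = kform t s.
Proof.
move=> bs bt.
have im0 a : complex.Im (a * kform t s + a^* * kform s t) = 0.
  have : 0 <= kform (s ++ lscale a t) (s ++ lscale a t).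
    by apply: kform_ge0; rewrite ball_list_cat ball_list_lscale bs bt.
  move/ger0_Im; rewrite kform_catr !kform_catl !kform_lscalel !kform_lscaler.
  have /ger0_Im h1 := kform_ge0 bs.
  have /ger0_Im h3 : 0 <= a * (a^* * kform t t).
    by rewrite mulrA mulr_ge0 ?kform_ge0 // mul_conjC_ge0.
  rewrite !raddfD /= h1 h3; lra.
have := im0 1; have := im0 'i%C.
rewrite rmorph1 !mul1r !raddfD /=.
rewrite -[(kform s t)^*]/(conjc _) -['i%C^*]/(conjc _).
case: (kform s t) (kform t s) => [a b] [a' b'] /=.
by move=> h1 h2; congr (_ +i* _); lra.
Qed.

Definition kre s t : R := complex.Re (kform s t).

Lemma kre_ge0 s : ball_list s -> 0 <= kre s s.
Proof. by move=> /kform_ge0; rewrite lecE => /andP[]. Qed.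

Lemma kreE s : ball_list s -> kform s s = (kre s s)%:C.
Proof. by move=> /kform_ge0/ger0_Im; rewrite /kre; case: kform => [a b] /= ->. Qed.

Lemma Re_conj a : complex.Re a^* = complex.Re a.
Proof. by case: a. Qed.

Lemma ReD a b : complex.Re (a + b) = complex.Re a + complex.Re b.
Proof. by case: a b => [x y] [x' y']. Qed.

Lemma Re_realM (x : R) a : complex.Re (x%:C * a) = x * complex.Re a.
Proof. by case: a => p q /=; rewrite mul0r subr0. Qed.

Lemma kre_addscale x s t : ball_list s -> ball_list t ->
  kre (s ++ lscale x%:C t) (s ++ lscale x%:C t)
    = kre s s + 2 * x * kre s t + x ^+ 2 * kre t t.
Proof.
move=> bs bt; rewrite /kre kform_catr !kform_catl !kform_lscalel !kform_lscaler.
rewrite conj_realC !ReD !Re_realM -(kform_conj bs bt) Re_conj.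
by ring.
Qed.

(* With [g = kform s t], positivity on [s + x g t] for real [x] reads
   [kform s s + 2 x |g|^2 + x^2 |g|^2 kform t t >= 0]. *)
Lemma kform_cauchy_schwarz s t : ball_list s -> ball_list t ->
  `|kform s t| ^+ 2 <= kform s s * kform t t.
Proof.
move=> bs bt; pose g := kform s t; pose t' := lscale g t.
have bt' : ball_list t' by rewrite ball_list_lscale.
have [B gB] : exists B : R, `|g| ^+ 2 = B%:C.
  by exists (complex.Re g ^+ 2 + complex.Im g ^+ 2); rewrite add_Re2_Im2.
have B0 : 0 <= B by rewrite -(ler0c B) -gB exprn_ge0.
have st' : kre s t' = B.
  by rewrite /kre kform_lscaler mulrC -normCK gB.
have tt' : kre t' t' = B * kre t t.
  by rewrite /kre kform_lscalel kform_lscaler mulrA -normCK gB Re_realM.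
have H x : 0 <= kre s s + 2 * x * B + x ^+ 2 * (B * kre t t).
  rewrite -{1}st' -tt' -kre_addscale //; apply: kre_ge0.
  by rewrite ball_list_cat ball_list_lscale bs bt'.
rewrite !kreE // -/g gB -rmorphM lecR.
have s0 := kre_ge0 bs; have t0 := kre_ge0 bt.
move: (kre s s) (kre t t) s0 t0 H => A D A0 D0 H.
(* For [D = 0] the expression is affine in [x], and [B > 0] would let it reach [-1]; otherwise it is
   minimal at [x = - D^-1]. *)
have [D0'|Dn0] := eqVneq D 0.
  rewrite {}D0' in H *; rewrite mulr0 leNgt; apply/negP => Bp.
  have := H (- (A + 1) / (2 * B)); rewrite leNgt => /negP; apply.
  rewrite [ltLHS](_ : _ = -1) ?ltrN10 //; field.
  by rewrite gt_eqF.
have Dp : 0 < D by rewrite lt_neqAle eq_sym Dn0.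
have := H (- D^-1); rewrite [X in _ <= X](_ : _ = (A * D - B) / D); last by field.
by rewrite pmulr_lge0 ?invr_gt0 // subr_ge0.
Qed.

(** Cauchy-Schwarz bounds the pairing for each approximant of [f], and the bound passes to the
    pointwise limit. *)
Lemma HK_le_pairing f c : HK_le K f c -> forall t, ball_list t ->
  `|pairing f t| ^+ 2 <= (c ^+ 2)%:C * kform t t.
Proof.
move=> [c0 [s [bs [_ [sf sc]]]]] t bt.
rewrite kreE // -rmorphM; apply: (ccvg_norm_sqr_le (pairing_cvg bt sf)) => e e0.
have t1 : 0 < kre t t + 1 by rewrite ltr_wpDl ?kre_ge0.
have [|N hN] := sc (e / (kre t t + 1)); first by rewrite divr_gt0.
exists N => n /hN; rewrite knorm2E => h.
apply: le_trans (kform_cauchy_schwarz (bs n) bt) _.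
move: h; rewrite !kreE // -rmorphM ltcR lecR => h.
apply: (@le_trans _ _ ((c ^+ 2 + e / (kre t t + 1)) * kre t t)).
  by rewrite ler_wpM2r ?kre_ge0 // ltW.
rewrite mulrDl lerD2l mulrAC ler_pdivrMr // ler_pM2l // lerDl //.
Qed.

(** * Existence in the Riesz representation, by minimising a quadratic functional *)

Section Riesz.
Variables (f : V -> V) (c : R).
Hypothesis c0 : 0 <= c.
Hypothesis fc : forall t, ball_list t ->
  `|pairing f t| ^+ 2 <= (c ^+ 2)%:C * kform t t.

Let pre t : R := complex.Re (pairing f t).
(** For [f] in [H_K] this would be the squared distance from [f] to [kfun K s], minus the squared
    norm of [f]. A minimising sequence will approximate [f]. *)
Let J s : R := kre s s - 2 * pre s.

Let pre_sqr t : ball_list t -> pre t ^+ 2 <= c ^+ 2 * kre t t.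
Proof.
move=> bt; have := fc bt; rewrite kreE // -rmorphM -add_Re2_Im2 lecR.
by apply: le_trans; rewrite lerDl sqr_ge0.
Qed.

(** By [pre_sqr] and the arithmetic-geometric mean inequality,
    [(2 p)^2 <= 4 c^2 n <= (c^2 + n)^2]. *)
Let J_lb s : ball_list s -> - c ^+ 2 <= J s.
Proof.
move=> bs; have := pre_sqr bs; have := kre_ge0 bs; rewrite /J.
move: (kre s s) (pre s) => n p n0 pn.
rewrite lerNl opprB lerBlDr leNgt; apply/negP => h.
have : (c ^+ 2 + n) ^+ 2 < (2 * p) ^+ 2.
  by rewrite ltr_sqr ?nnegrE ?addr_ge0 ?sqr_ge0 //;
    apply: le_trans (ltW h); rewrite addr_ge0 ?sqr_ge0.
have := sqr_ge0 (c ^+ 2 - n); nra.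
Qed.

Let Jset : set R := [set x | exists2 s, ball_list s & x = J s]%classic.

Let Jset_inf : has_inf Jset.
Proof.
split; first by exists (J [::]), [::].
by exists (- c ^+ 2) => _ [s bs ->]; apply: J_lb.
Qed.

Let m := inf Jset.

Let m_le s : ball_list s -> m <= J s.
Proof. by move=> bs; apply: ge_inf; [case: Jset_inf | exists s]. Qed.

Let J_addscale x s t : ball_list s -> ball_list t ->
  J (s ++ lscale x%:C t) = J s + 2 * x * (kre s t - pre t) + x ^+ 2 * kre t t.
Proof.
move=> bs bt; rewrite /J kre_addscale // /pre pairing_cat pairing_lscale.
by rewrite conj_realC ReD Re_realM; ring.
Qed.

(** First variation: [J] drops by at most [e] on moving from [s] to [s - r / (T + 1) t]. The step
    uses [T + 1] rather than [T] to allow [T = 0]. *)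
Let almost_orthogonal e s t : 0 <= e -> ball_list s -> ball_list t -> J s <= m + e ->
  (kre s t - pre t) ^+ 2 <= e * (kre t t + 1).
Proof.
move=> e0 bs bt Js; have T0 := kre_ge0 bt.
set r := kre s t - pre t; set T := kre t t in T0 *.
have T1 : 0 < T + 1 by rewrite ltr_wpDl.
have : m <= J (s ++ lscale (- (r / (T + 1)))%:C t).
  by apply: m_le; rewrite ball_list_cat ball_list_lscale bs bt.
rewrite J_addscale // -/r -/T => h.
have {h} : 0 <= e - 2 * (r / (T + 1)) * r + (r / (T + 1)) ^+ 2 * T.
  by move: h; rewrite sqrrN; lra.
rewrite [X in _ <= X](_ : _ = (e * (T + 1) - r ^+ 2 - r ^+ 2 / (T + 1)) / (T + 1)); last first.
  by field; rewrite gt_eqF.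
rewrite pmulr_lge0 ?invr_gt0 // => h; rewrite -subr_ge0; apply: le_trans h _.
by rewrite gerBl divr_ge0 ?sqr_ge0 // ltW.
Qed.

(** The squared norm of [s - t] equals [2 J s + 2 J t] minus four times [J] at the midpoint, where
    [J] is at least [m]. *)
Let parallelogram e s t : ball_list s -> ball_list t -> J s <= m + e -> J t <= m + e ->
  kre (s ++ lscale (-1) t) (s ++ lscale (-1) t) <= 4 * e.
Proof.
move=> bs bt Js Jt.
have bst : ball_list (s ++ lscale 1%:C t) by rewrite ball_list_cat ball_list_lscale bs bt.
have : m <= J (lscale (2^-1)%:C (s ++ lscale 1%:C t)).
  by apply: m_le; rewrite ball_list_lscale.
have -> : -1 = (-1)%:C :> C by rewrite rmorphN1.
rewrite /J /pre pairing_lscale pairing_cat pairing_lscale /kre kform_lscalel kform_lscaler.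
rewrite !conj_realC !(ReD, Re_realM) -!/(kre _ _) !kre_addscale //.
move: Js Jt; rewrite /J /pre; lra.
Qed.

Let Re_pairing_cvg (s : nat -> seq (V * V)) t e :
    (forall n, ball_list (s n) /\ J (s n) <= m + n.+1%:R^-1) -> ball_list t -> 0 < e ->
  exists N : nat, forall n, (N <= n)%N ->
    (kre (s n) t - pre t) ^+ 2 < e.
Proof.
move=> hs bt e0; have T1 : 0 < kre t t + 1 by rewrite ltr_wpDl ?kre_ge0.
have [|N hN] := @inv_succ_small R (e / (kre t t + 1)); first by rewrite divr_gt0.
exists N => n /hN h; have [bs Js] := hs n.
apply: le_lt_trans (almost_orthogonal _ bs bt Js) _; first by rewrite invr_ge0.
by rewrite -ltr_pdivlMr.
Qed.

(** A minimising sequence is Cauchy by [parallelogram], and [almost_orthogonal] identifies its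
    pointwise limit with [f]. This is the converse of [HK_le_pairing]. *)
Lemma riesz : HK_le K f c.
Proof.
split=> //.
have /choice[s hs] n : exists s, ball_list s /\ J s <= m + n.+1%:R^-1.
  have [|_ [s bs ->] /ltW h] := @inf_adherent _ Jset n.+1%:R^-1 _ Jset_inf.
    by rewrite invr_gt0.
  by exists s.
exists s; split; first by move=> n; case: (hs n).
split=> [e e0|].
  have [|N hN] := @inv_succ_small R (e / 4); first by rewrite divr_gt0.
  exists N => k n /hN hk /hN hn; have [bk Jk] := hs k; have [bn Jn] := hs n.
  have bkn : ball_list (s k ++ lscale (-1) (s n)).
    by rewrite ball_list_cat ball_list_lscale bk bn.
  rewrite kdiffE knorm2E kreE // ltcR.
  pose x := Num.max k.+1%:R^-1 n.+1%:R^-1 : R.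
  have xe : x < e / 4 by rewrite /x gt_max hk hn.
  apply: (@le_lt_trans _ _ (4 * x)); last by rewrite mulrC -ltr_pdivlMr.
  apply: parallelogram => //; [apply: le_trans Jk _|apply: le_trans Jn _];
    by rewrite lerD2l le_max lexx ?orbT.
split=> [z bz i e e0|e e0].
  have e2 : 0 < e ^+ 2 / 2 by rewrite divr_gt0 ?exprn_gt0.
  (* Only real parts of pairings are controlled; the factor ['i] in the second test vector recovers
     the imaginary part. *)
  have b1 : ball_list [:: (z, delta_mx i 0 : V)] by rewrite /= bz.
  have b2 : ball_list [:: (z, 'i%C *: delta_mx i 0 : V)] by rewrite /= bz.
  have [N hN] := Re_pairing_cvg hs b1 e2; have [M hM] := Re_pairing_cvg hs b2 e2.
  exists (maxn N M) => n; rewrite geq_max => /andP[/hN + /hM].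
  rewrite /kre /pre /kform !pairing1 !cinnerZr !cinner_delta.
  rewrite -['i%C^*]/(0 -i* 1) /cabs.
  case: (kfun K (s n) z i 0) (f z i 0) => [a b] [a' b'] /=.
  rewrite !mul0r !sub0r !mulN1r !opprK => h1 h2.
  rewrite -[ltRHS](gtr0_norm e0) -sqrtr_sqr ltr_sqrt ?exprn_gt0 //.
  rewrite [e ^+ 2]splitr; apply: ltrD; first exact: h1.
  apply: le_lt_trans h2; rewrite le_eqVlt; apply/orP/or_introl/eqP; ring.
(* [B] bounds [nn + 1] along the sequence, where [nn] is the squared norm of [s n]; this makes the
   error in [almost_orthogonal] at [t = s n] uniformly small. *)
pose B := 5 + 4 * c ^+ 2.
have B0 : 0 < B by rewrite /B ltr_wpDr // mulr_ge0 ?sqr_ge0.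
have [|N hN] := @inv_succ_small R ((e / 3) ^+ 2 / B).
  by rewrite divr_gt0 ?exprn_gt0 ?divr_gt0.
exists N => n /hN h; have [bs Js] := hs n.
rewrite knorm2E kreE // ltcR.
have d1 : n.+1%:R^-1 <= 1 :> R by rewrite invf_le1 ?ler1n ?ltr0n.
have := almost_orthogonal _ bs bs Js; rewrite invr_ge0 ler0n => /(_ isT).
have := pre_sqr bs; have := kre_ge0 bs.
have m0 : m <= 0.
  have := @m_le [::] isT.
  by rewrite /J /kre /pre /kform /pairing !big_nil /= mulr0 subr0.
move: Js; rewrite /J; move: (kre (s n) (s n)) (pre (s n)) => nn p Js n0 pn orth.
(* Weighted arithmetic-geometric mean inequality from [p^2 <= c^2 nn]: [x = 2] bounds [nn], and
   [x = 1] with [nn] close to [p] gives [nn < c^2 + e]. *)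
have AM x : 0 < x -> 2 * p <= c ^+ 2 * x + nn / x.
  move=> x0; rewrite leNgt; apply/negP => lt.
  have L0 : 0 <= c ^+ 2 * x + nn / x by rewrite addr_ge0 ?divr_ge0 ?mulr_ge0 ?sqr_ge0 ?(ltW x0).
  have : (c ^+ 2 * x + nn / x) ^+ 2 < (2 * p) ^+ 2.
    by rewrite ltr_sqr ?nnegrE // (le_trans L0) // ltW.
  have -> : (c ^+ 2 * x + nn / x) ^+ 2 = (c ^+ 2 * x - nn / x) ^+ 2 + 4 * (c ^+ 2 * nn).
    by field; rewrite gt_eqF.
  by have := sqr_ge0 (c ^+ 2 * x - nn / x); nra.
have nB : nn + 1 <= B.
  have := AM 2 (ltr0Sn _ 1); move: d1 Js; rewrite /B.
  by move: (n.+1%:R^-1) (c ^+ 2) => y q; lra.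
have : (nn - p) ^+ 2 < (e / 3) ^+ 2.
  apply: le_lt_trans orth _.
  apply: (@le_lt_trans _ _ (n.+1%:R^-1 * B)); first by rewrite ler_wpM2l ?invr_ge0.
  by rewrite -ltr_pdivlMr.
move=> h2; have {h2} : nn - p < e / 3.
  rewrite ltNge; apply/negP => h3; move: h2; rewrite ltNge => /negP; apply.
  have e3 : 0 <= e / 3 by rewrite divr_ge0 // ltW.
  by rewrite ler_sqr ?nnegrE // (le_trans e3).
by have := AM 1 ltr01; rewrite mulr1 divr1; lra.
Qed.
End Riesz.
End Form.

(** * Boundedness of the coordinate multiplications *)

Section Boundedness.
Local Open Scope ring_scope.
Variables (R : realType) (d : nat).
Local Notation C := R[i].
Local Notation V := 'cV[C]_d.
Variable K : V -> V -> 'M[C]_d.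
Hypothesis K_ge0 : nonneg_kernel K.
Implicit Types (s t : seq (V * V)) (f : V -> V) (i : 'I_d).

(* The adjoint of multiplication by [z i] on the span of the kernel functions. *)
Definition adjmul i t : seq (V * V) := [seq (p.1, (p.1 i 0)^* *: p.2) | p : V * V <- t].

Lemma ball_list_adjmul i t : ball_list (adjmul i t) = ball_list t.
Proof. by rewrite /ball_list all_map. Qed.

Lemma pairing_mulz i f t : pairing (mulz i f) t = pairing f (adjmul i t).
Proof.
rewrite /pairing big_map; apply: eq_bigr => p _ /=.
by rewrite cinnerZl cinnerZr conjCK.
Qed.

Lemma sum_kform_adjmul t :
  \sum_i kform K (adjmul i t) (adjmul i t)
    = kform (fun z w => cinner z w *: K z w) t t.
Proof.
rewrite /kform /pairing.
under eq_bigr do rewrite big_map.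
rewrite exchange_big; apply: eq_bigr => q _ /=.
rewrite /kfun; under eq_bigr do rewrite big_map cinner_suml.
rewrite exchange_big cinner_suml; apply: eq_bigr => p _ /=.
rewrite -scalemxAl cinnerZl /cinner mulr_suml; apply: eq_bigr => i _.
rewrite -scalemxAr -/(cinner _ _) cinnerZl cinnerZr conjCK mulrA; congr (_ * _).
exact: mulrC.
Qed.

Lemma kform_mul_sub (c : R) t :
  kform (fun z w => (c%:C - cinner z w) *: K z w) t t
    = c%:C * kform K t t - \sum_i kform K (adjmul i t) (adjmul i t).
Proof.
rewrite sum_kform_adjmul /kform /pairing mulr_sumr -sumrB; apply: eq_bigr => q _.
rewrite /kfun !cinner_suml mulr_sumr -sumrB; apply: eq_bigr => p _.
by rewrite -!scalemxAl !cinnerZl mulrBl.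
Qed.

(** Apply the bound to [kfun K t'], with [t' = adjmul i t]. Pairing its product by [z i] with [t]
    gives the squared norm [x] of [t'], so [x^2 <= B^2 x y], and one factor [x] cancels. *)
Lemma mult_bounded_adjmul i : mult_bounded K i ->
  exists B : R, forall t, ball_list t ->
    kform K (adjmul i t) (adjmul i t) <= (B ^+ 2)%:C * kform K t t.
Proof.
move=> [B hB]; exists B => t bt; set t' := adjmul i t.
have bt' : ball_list t' by rewrite ball_list_adjmul.
pose c := Num.sqrt (kre K t' t').
have c2 : c ^+ 2 = kre K t' t' by rewrite sqr_sqrtr ?kre_ge0.
have fc : HK_le K (kfun K t') c.
  apply: riesz => //; first exact: sqrtr_ge0.
  by move=> s bs; rewrite c2 -kreE //; apply: kform_cauchy_schwarz.
have := HK_le_pairing K_ge0 (hB _ _ fc) bt.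
rewrite pairing_mulz -/t' -/(kform K t' t') !kreE //.
rewrite exprMn c2 ger0_norm ?ler0c ?kre_ge0 // -!rmorphXn -!rmorphM !lecR.
have := kre_ge0 K_ge0 bt; have := kre_ge0 K_ge0 bt'.
move: (kre K t' t') (kre K t t) => x y.
rewrite le_eqVlt => /predU1P[<- y0 _|x0 y0]; first by rewrite mulr_ge0 ?sqr_ge0.
by rewrite mulrAC expr2 ler_pM2r.
Qed.

(** By [kform_mul_sub] positivity says that the squared norms of the [adjmul i t] sum to at most [c]
    times that of [t]. One direction adds the bounds over [i], the other keeps a single summand. *)
Lemma tuple_boundedP : tuple_bounded K <->
  exists c : R, nonneg_kernel (fun z w => (c%:C - cinner z w) *: K z w).
Proof.
split=> [hK|[c /nonneg_kformP hc] i].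
  have /choice[B hB] i := mult_bounded_adjmul (hK i).
  exists (\sum_i B i ^+ 2); apply/nonneg_kformP => t bt.
  rewrite kform_mul_sub subr_ge0 rmorph_sum mulr_suml /=.
  by apply: ler_sum => i _; apply: hB.
(* The sign of [c] is not known here. *)
exists (Num.sqrt `|c|) => f e fe; apply: riesz => //.
  by rewrite mulr_ge0 ?sqrtr_ge0 //; case: fe.
move=> t bt; rewrite pairing_mulz.
have bt' : ball_list (adjmul i t) by rewrite ball_list_adjmul.
apply: le_trans (HK_le_pairing K_ge0 fe bt') _.
rewrite exprMn [_ * e ^+ 2]mulrC sqr_sqrtr // [(_ * `|c|)%:C]rmorphM -mulrA.
apply: ler_wpM2l; first by rewrite ler0c sqr_ge0.
have := hc t bt; rewrite kform_mul_sub subr_ge0 (bigD1 i) //= => h.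
apply: (@le_trans _ _ (c%:C * kform K t t)).
  apply: le_trans h; rewrite lerDl sumr_ge0 // => j _.
  by apply: kform_ge0; rewrite ?ball_list_adjmul.
by rewrite ler_wpM2r ?kform_ge0 // lecR ler_norm.
Qed.
End Boundedness.

(** * Contraction of symmetric tensors *)

Section Words.
Local Open Scope ring_scope.
Variable C : numClosedFieldType.

(** Expand the sum of [(a i * W - A * w i)^2 / w i], which is non-negative and equals
    [W (W Q - A^2)]; [W = 0] can occur only for empty [I]. *)
Lemma weighted_cauchy_schwarz (I : finType) (x w : I -> C) : (forall i, 0 < w i) ->
  `|\sum_i x i| ^+ 2 <= (\sum_i w i) * \sum_i `|x i| ^+ 2 / w i.
Proof.
move=> w0; pose a i := `|x i|.
have a0 i : 0 <= a i by exact: normr_ge0.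
apply: (@le_trans _ _ ((\sum_i a i) ^+ 2)).
  by rewrite ler_sqr ?nnegrE ?sumr_ge0 ?ler_norm_sum.
set A := \sum_i a i; set W := \sum_i w i; set Q := \sum_i `|x i| ^+ 2 / w i.
have W0 : 0 <= W by apply: sumr_ge0 => i _; exact: ltW.
have := W0; rewrite le_eqVlt => /predU1P[W00|Wp].
  rewrite -W00 mul0r /A big1 ?expr0n // => i _; have := w0 i.
  have /eqP := esym W00; rewrite psumr_eq0 => [/allP/(_ i)|j _]; last exact: ltW.
  by rewrite mem_index_enum => /(_ isT) /eqP ->; rewrite ltxx.
have A0 : 0 <= A by exact: sumr_ge0.
have : 0 <= \sum_i (a i * W - A * w i) ^+ 2 / w i.
  apply: sumr_ge0 => i _; rewrite mulr_ge0 ?invr_ge0 ?(ltW (w0 i)) //.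
  apply: real_exprn_even_ge0 => //.
  by rewrite realB ?realM ?ger0_real // (ltW (w0 i)).
rewrite (_ : \sum_i _ = W * (W * Q - A ^+ 2)); first by rewrite pmulr_rge0 // subr_ge0.
rewrite (eq_bigr (fun i => W ^+ 2 * (`|x i| ^+ 2 / w i) - 2 * W * A * a i + A ^+ 2 * w i)).
  rewrite big_split sumrB -!mulr_sumr -/A -/W -/Q /=; ring.
by move=> i _; rewrite -/(a i); field; rewrite gt_eqF.
Qed.

Variables n d : nat.

(** Words of length [n] over ['I_d] index the standard basis of the n-th tensor power of [C^d]. *)
Definition wcons (i : 'I_d) (w : {ffun 'I_n -> 'I_d}) : {ffun 'I_n.+1 -> 'I_d} :=
  [ffun j => if unlift ord0 j is Some j' then w j' else i].

Definition wcount (m : nat) (i : 'I_d) (w : {ffun 'I_m -> 'I_d}) : nat :=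
  \sum_j (w j == i).

Lemma wcons0 i w : wcons i w ord0 = i.
Proof. by rewrite ffunE unlift_none. Qed.

Lemma wconsS i w j : wcons i w (lift ord0 j) = w j.
Proof. by rewrite ffunE liftK. Qed.

Lemma sum_wcons (G : {ffun 'I_n.+1 -> 'I_d} -> C) :
  \sum_w G w = \sum_i \sum_w G (wcons i w).
Proof.
rewrite pair_big /=.
rewrite (reindex (fun p : 'I_d * {ffun 'I_n -> 'I_d} => wcons p.1 p.2)) //=.
exists (fun w : {ffun 'I_n.+1 -> 'I_d} => (w ord0, [ffun j => w (lift ord0 j)])).
  move=> [i w] _; rewrite /= wcons0; congr pair.
  by apply/ffunP => j; rewrite ffunE wconsS.
move=> w _; apply/ffunP => j; rewrite ffunE /=.
by case: unliftP => [j' ->|->] //; rewrite ffunE.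
Qed.

Lemma wcount_wcons i w : wcount i (wcons i w) = (wcount i w).+1.
Proof.
rewrite /wcount big_ord_recl wcons0 eqxx; congr (_.+1).
by apply: eq_bigr => j _; rewrite wconsS.
Qed.

Lemma sum_wcount (w : {ffun 'I_n -> 'I_d}) : (\sum_i wcount i w = n)%N.
Proof.
rewrite exchange_big /= -[RHS]card_ord -sum1_card; apply: eq_bigr => j _.
by rewrite (bigD1 (w j)) //= eqxx big1 // => i; rewrite eq_sym => /negbTE->.
Qed.

Definition wswap (j : 'I_n.+1) (w : {ffun 'I_n.+1 -> 'I_d}) : {ffun 'I_n.+1 -> 'I_d} :=
  [ffun k => w (tperm ord0 j k)].

Lemma wswapK j : involutive (wswap j).
Proof. by move=> w; apply/ffunP => k; rewrite !ffunE tpermK. Qed.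

Lemma wcount_wswap i j w : wcount i (wswap j w) = wcount i w.
Proof.
rewrite /wcount [RHS](reindex_inj (@perm_inj _ (tperm ord0 j))) /=.
by apply: eq_bigr => k _; rewrite ffunE.
Qed.

(** By symmetry of [G], a letter [i] at any position can be swapped to the front; summing over the
    [n.+1] positions counts the occurrences of [i]. *)
Lemma sum_wcons_position (G : {ffun 'I_n.+1 -> 'I_d} -> C) i :
    (forall j w, G (wswap j w) = G w) ->
  n.+1%:R * \sum_w G (wcons i w) = \sum_w (wcount i w)%:R * G w.
Proof.
move=> Gsym.
have E j : \sum_(w : {ffun 'I_n.+1 -> 'I_d}) (w j == i)%:R * G w
           = \sum_w G (wcons i w).
  rewrite (reindex_inj (inv_inj (wswapK j))) /=.
  under eq_bigr do rewrite Gsym ffunE tpermR.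
  rewrite sum_wcons (bigD1 i) //= [X in _ + X]big1 ?addr0 => [|i' ii'].
    by apply: eq_bigr => w _; rewrite wcons0 eqxx mul1r.
  by apply: big1 => w _; rewrite wcons0 (negbTE ii') mul0r.
transitivity (\sum_(j < n.+1) \sum_w G (wcons i w)).
  by rewrite sumr_const card_ord mulr_natl.
rewrite (eq_bigr _ (fun j _ => esym (E j))) exchange_big.
by apply: eq_bigr => w _; rewrite -mulr_suml natr_sum.
Qed.

(* Cauchy-Schwarz over [i], weighted by the multiplicity of [i] in the word [wcons i w]; these
   multiplicities add up to n + d. *)
Lemma contraction_bound (F : 'I_d -> {ffun 'I_n.+1 -> 'I_d} -> C) :
    (forall i j w, F i (wswap j w) = F i w) ->
  n.+1%:R * \sum_w `|\sum_i F i (wcons i w)| ^+ 2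
    <= (n + d)%:R * \sum_i \sum_w `|F i w| ^+ 2.
Proof.
move=> Fsym.
pose G i (w : {ffun 'I_n.+1 -> 'I_d}) := `|F i w| ^+ 2 / (wcount i w)%:R.
have CS w : `|\sum_i F i (wcons i w)| ^+ 2 <= (n + d)%:R * \sum_i G i (wcons i w).
  have -> : (n + d)%:R = \sum_i (wcount i (wcons i w))%:R :> C.
    rewrite -natr_sum; under eq_bigr do rewrite wcount_wcons -addn1.
    by rewrite big_split /= sum_wcount sum1_card card_ord.
  by apply: weighted_cauchy_schwarz => i; rewrite wcount_wcons ltr0n.
apply: (@le_trans _ _ (n.+1%:R * \sum_w (n + d)%:R * \sum_i G i (wcons i w))).
  by rewrite ler_wpM2l ?ler0n //; apply: ler_sum => w _.
rewrite -mulr_sumr mulrCA ler_wpM2l ?ler0n // exchange_big mulr_sumr.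
apply: ler_sum => i _; rewrite sum_wcons_position => [|j w]; last first.
  by rewrite /G Fsym wcount_wswap.
(* A word without the letter [i] contributes 0 on the left, so only the sign of the right side
   matters; otherwise the multiplicity cancels. *)
apply: ler_sum => w _; rewrite /G; case: (wcount i w) => [|k].
  by rewrite mul0r exprn_ge0.
by rewrite mulrC divfK // pnatr_eq0.
Qed.
End Words.

(** * Homogeneous kernels *)

Section Homogeneous.
Local Open Scope ring_scope.
Variables (R : realType) (d : nat).
Local Notation C := R[i].
Local Notation V := 'cV[C]_d.

(* The degree [l] part of the kernel; the coefficient [a] is meaningful for [0 < l] only. *)
Definition homk (a b : C) (l : nat) (z w : V) : 'M[C]_d :=
  (a * cinner z w ^+ l.-1) *: zwdag z w + (b * cinner z w ^+ l) *: 1%:M.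

(** Points are indexed by any finite type because later configurations are indexed by products. *)
Definition qform (K : V -> V -> 'M[C]_d) (I : finType) (pts vs : I -> V) : C :=
  \sum_k \sum_m cinner (K (pts k) (pts m) *m vs m) (vs k).

Lemma nonneg_kernel_qform (K : V -> V -> 'M[C]_d) (I : finType) (pts vs : I -> V) :
  nonneg_kernel K -> (forall k, inBall (pts k)) -> 0 <= qform K pts vs.
Proof.
move=> K0 bp; rewrite /qform big_enum_val.
under eq_bigr do rewrite big_enum_val.
exact: (K0 #|I| (fun k => pts (enum_val k)) (fun k => vs (enum_val k))).
Qed.

Lemma cinner_homk (a b : C) l (z w u v : V) :
  cinner (homk a b l z w *m v) u =
    a * (cinner z w ^+ l.-1 * (cinner v w * cinner z u)) + b * (cinner z w ^+ l * cinner v u).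
Proof.
have zwv : zwdag z w *m v = cinner v w *: z.
  apply/matrixP => i j; rewrite ord1 !mxE mulrC /cinner mulr_sumr.
  by apply: eq_bigr => k _; rewrite mxE -mulrA [_ * v k 0]mulrC.
by rewrite mulmxDl -!scalemxAl mul1mx zwv cinnerDl !cinnerZl !mulrA.
Qed.

Lemma cinner_ge0 (v : V) : 0 <= cinner v v.
Proof. by apply: sumr_ge0 => i _; apply: mul_conjC_ge0. Qed.

Lemma cinner_sumr (I : Type) (r : seq I) (P : pred I) (F : I -> V) (z : V) :
  cinner z (\sum_(i <- r | P i) F i) = \sum_(i <- r | P i) cinner z (F i).
Proof.
by rewrite -cinner_conj cinner_suml conjC_sum; apply: eq_bigr => i _; rewrite cinner_conj.
Qed.

Lemma normC_sum_sqr (I : finType) (x : I -> C) :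
  `|\sum_m x m| ^+ 2 = \sum_k \sum_m x m * (x k)^*.
Proof.
rewrite normCK conjC_sum mulr_sumr; apply: eq_bigr => k _.
by rewrite mulr_suml.
Qed.

Lemma cinner_exp (n : nat) (z w : V) :
  cinner z w ^+ n
    = \sum_(u : {ffun 'I_n -> 'I_d}) \prod_j (z (u j) 0 * (w (u j) 0)^*).
Proof.
rewrite -(bigA_distr_bigA (fun=> fun i => z i 0 * (w i 0)^*)).
by rewrite prodr_const card_ord.
Qed.

Lemma conjC_prod (I : finType) (x : I -> C) : (\prod_k x k)^* = \prod_k (x k)^*.
Proof. exact: rmorph_prod. Qed.

(** [cinner z w ^+ n] is the inner product of the n-th tensor powers of [z] and [w], so the right
    side is a squared norm of a tensor. *)
Lemma sum_words (n : nat) (I : finType) (pts : I -> V) (c : I -> C) :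
  \sum_(u : {ffun 'I_n -> 'I_d}) `|\sum_m (\prod_j (pts m (u j) 0)^*) * c m| ^+ 2
    = \sum_k \sum_m cinner (pts k) (pts m) ^+ n * (c m * (c k)^*).
Proof.
under eq_bigr do rewrite normC_sum_sqr.
rewrite exchange_big; apply: eq_bigr => k _.
rewrite exchange_big; apply: eq_bigr => m _.
rewrite cinner_exp mulr_suml; apply: eq_bigr => u _.
rewrite conjCM conjC_prod mulrACA; congr (_ * _).
by rewrite -big_split; apply: eq_bigr => j _; rewrite /= conjCK mulrC.
Qed.

(** For [l = n.+1] the form is [a S1 + b S2], with [S2] the squared norm of the tensor [F] and [S1]
    that of its contraction. Multiplied by [n + d] it becomes [((n+d) a + (n+1) b) S1 + b ((n+d) S2
    - (n+1) S1)], and [contraction_bound] handles the last bracket. *)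
Lemma qform_homk_ge0 (a b : C) l (I : finType) (pts vs : I -> V) :
    (l = 0%N -> a = 0) -> 0 <= b ->
    (forall n, l = n.+1 -> 0 <= (n + d)%:R * a + n.+1%:R * b) ->
  0 <= qform (homk a b l) pts vs.
Proof.
move=> a0 b0 ab; rewrite /qform.
under eq_bigr do under eq_bigr do rewrite cinner_homk.
case: l a0 ab => [a0 _|n _ ab].
  rewrite a0 //; under eq_bigr do under eq_bigr do rewrite mul0r add0r expr0 mul1r.
  under eq_bigr do rewrite -mulr_sumr -cinner_suml.
  by rewrite -mulr_sumr -cinner_sumr mulr_ge0 ?cinner_ge0.
pose F i (w : {ffun 'I_n.+1 -> 'I_d}) : C :=
  \sum_m (\prod_j (pts m (w j) 0)^*) * vs m i 0.
pose S1 := \sum_w `|\sum_i F i (wcons i w)| ^+ 2.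
pose S2 := \sum_i \sum_w `|F i w| ^+ 2.
have S1E : S1 = \sum_k \sum_m cinner (pts k) (pts m) ^+ n *
    (cinner (vs m) (pts m) * cinner (pts k) (vs k)).
  rewrite [RHS](eq_bigr (fun k => \sum_m cinner (pts k) (pts m) ^+ n *
    (cinner (vs m) (pts m) * (cinner (vs k) (pts k))^*))); last first.
    by move=> k _; apply: eq_bigr => m _; rewrite cinner_conj.
  rewrite -sum_words; apply: eq_bigr => w _; congr (`|_| ^+ 2).
  rewrite exchange_big; apply: eq_bigr => m _; rewrite /cinner mulr_sumr.
  apply: eq_bigr => i _; rewrite big_ord_recl wcons0 /=.
  under eq_bigr do rewrite wconsS.
  by rewrite -mulrA mulrCA [_ * vs m i 0]mulrC.
have S2E : S2 = \sum_k \sum_m cinner (pts k) (pts m) ^+ n.+1 * cinner (vs m) (vs k).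
  rewrite /S2; under eq_bigr do rewrite sum_words.
  rewrite exchange_big; apply: eq_bigr => k _.
  rewrite exchange_big; apply: eq_bigr => m _.
  by rewrite -mulr_sumr.
have S10 : 0 <= S1 by apply: sumr_ge0 => w _; rewrite exprn_ge0.
have Fsym i j w : F i (wswap j w) = F i w.
  apply: eq_bigr => m _; congr (_ * _).
  rewrite [RHS](reindex_inj (@perm_inj _ (tperm ord0 j))) /=.
  by apply: eq_bigr => k _; rewrite ffunE.
have := contraction_bound Fsym; rewrite -/S1 -/S2 => S12.
rewrite (_ : \sum_k _ = a * S1 + b * S2); last first.
  rewrite S1E S2E !mulr_sumr -big_split; apply: eq_bigr => k _.
  by rewrite /= !mulr_sumr -big_split.
have [nd0|nd] := posnP (n + d).
  have S20 : 0 <= S2 by apply: sumr_ge0 => i _; apply: sumr_ge0 => w _; rewrite exprn_ge0.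
  have : S1 = 0.
    apply/eqP; rewrite eq_le S10 andbT -(ler_pM2l (ltr0Sn C n)) mulr0.
    by rewrite (le_trans S12) // nd0 mul0r.
  by move->; rewrite mulr0 add0r mulr_ge0.
rewrite -(pmulr_rge0 _ (_ : 0 < (n + d)%:R)) ?ltr0n //.
have -> : (n + d)%:R * (a * S1 + b * S2) = ((n + d)%:R * a + n.+1%:R * b) * S1
    + b * ((n + d)%:R * S2 - n.+1%:R * S1).
  rewrite mulrDr mulrDl mulrBr !mulrA addrACA [b * _]mulrC -!addrA; congr (_ + _).
  by rewrite [b * n.+1%:R]mulrC subrr addr0.
by rewrite addr_ge0 // mulr_ge0 // ?subr_ge0 // ab.
Qed.
End Homogeneous.

(** * Isolating a homogeneous component *)

Section HomogeneousComponent.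
Local Open Scope ring_scope.
Variable R : realType.
Local Notation C := R[i].

(** The distinct nodes [j / n] give an invertible Vandermonde matrix, so the coefficient of index
    [k] of a polynomial of degree below [n] is a combination of its values there. *)
Lemma interpolation_weights (n : nat) (k : 'I_n) : exists t c : 'I_n -> R,
  (forall j, 0 <= t j <= 1) /\
  (forall m, (m < n)%N -> \sum_j c j * t j ^+ m = (m == k)%:R).
Proof.
have n0 : 0 < n%:R :> R by rewrite ltr0n; case: n k => [[]|].
pose t (j : 'I_n) : R := j%:R / n%:R.
pose M : 'M[R]_n := Vandermonde n (\row_j t j).
have MU : M \in unitmx.
  rewrite unitmxE unitfE det_Vandermonde; apply/prodf_neq0 => i _.
  apply/prodf_neq0 => j ij; rewrite !mxE subr_eq0 /t.
  by rewrite (inj_eq (mulIf (invr_neq0 (lt0r_neq0 n0)))) eqr_nat gtn_eqF.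
exists t, (fun j => (invmx M *m delta_mx k 0 : 'cV_n) j 0); split=> [j|m mn].
  by rewrite /t divr_ge0 //= ler_pdivrMr // mul1r ler_nat ltnW.
have := congr1 (fun A : 'cV_n => A (Ordinal mn) 0) (mulKVmx MU (delta_mx k 0 : 'cV_n)).
rewrite /= mxE => E; rewrite [RHS](_ : _ = (delta_mx k 0 : 'cV[R]_n) (Ordinal mn) 0); last first.
  by rewrite mxE andbT.
rewrite -E; apply: eq_bigr => j _; rewrite mulrC; congr (_ * _).
by rewrite /M /Vandermonde !mxE.
Qed.

Lemma sum_half_le n : \sum_(k < n) 2^-1 ^+ k <= 2 :> R.
Proof.
suff -> : \sum_(k < n) 2^-1 ^+ k = 2 - 2 * 2^-1 ^+ n :> R.
  by rewrite gerBl mulr_ge0 // exprn_ge0 // invr_ge0.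
elim: n => [|n ih]; first by rewrite big_ord0 expr0; ring.
by rewrite big_ord_recr /= ih exprS; field.
Qed.

(** With nodes [r * t j] whose moments below [l0] vanish, the series starts with [r^(2 l0) q l0] and
    its tail is of order [r^(2 l0 + 2)]. Dividing by [r^(2 l0)] approximates [q l0] by non-negative
    numbers as [r] tends to 0. *)
Lemma power_series_extract (q : nat -> C) :
    (forall n (t c : 'I_n -> R), (forall j, 0 <= t j <= 1) ->
      exists2 S : C, 0 <= S &
        ccvg (fun N => \sum_(l < N) ((\sum_j c j * t j ^+ l) ^+ 2)%:C * q l) S) ->
  forall l, 0 <= q l.
Proof.
move=> hq l0.
have [Q Q0 qQ] : exists2 Q : R, 0 <= Q & forall l, `|q l| <= Q%:C.
  (* The single node 1 makes the series of [q] itself converge, and each term is a difference of two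
     bounded partial sums. *)
  have [|S _ /ccvg_bounded[M hM]] := hq 1 (fun=> 1) (fun=> 1).
    by move=> j; rewrite ler01 lexx.
  have M0 : 0 <= M := le_trans (normr_ge0 _) (hM 0%N).
  have [M' MM'] : exists M', M = M'%:C.
    by exists (complex.Re M); rewrite RRe_real // ger0_real.
  exists (M' + M') => [|l]; first by rewrite addr_ge0 // -ler0c -MM'.
  rewrite rmorphD /= -MM'.
  have := lerD (hM l.+1) (hM l); rewrite big_ord_recr /= => h.
  apply: le_trans h; set s := \sum_(i < l) _.
  rewrite big_ord1 expr1n mulr1 expr1n rmorph1 mul1r.
  by rewrite -[X in `|X| <= _](addrK s) [q l + s]addrC; apply: ler_normB.
have [t [c [t01 mom]]] := interpolation_weights (ord_max : 'I_l0.+1).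
pose m l : R := \sum_j c j * t j ^+ l.
pose Mc : R := \sum_j `|c j|.
have Mc0 : 0 <= Mc by apply: sumr_ge0.
have mM l : `|m l| <= Mc.
  apply: le_trans (ler_norm_sum _ _ _) _; apply: ler_sum => j _.
  have /andP[tj0 tj1] := t01 j.
  by rewrite normrM normrX (ger0_norm tj0) ler_piMr // exprn_ile1.
pose D : R := 2 * Mc ^+ 2 * Q.
have D0 : 0 <= D by rewrite !mulr_ge0 ?sqr_ge0.
apply: ge0_approx => e e0.
have [e' ee'] : exists e', e = e'%:C.
  by exists (complex.Re e); rewrite RRe_real // ger0_real ?ltW.
have e'0 : 0 < e' by rewrite -(ltcR 0) -ee'.
(* [r <= 1/2] gives the tail a geometric majorant with sum 2, and the second bound brings [r^2 D]
   below [e' / 2]. *)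
pose r : R := Num.min 2^-1 (e' / 2 / (D + 1)).
have D1 : 0 < D + 1 by rewrite ltr_wpDl.
have r0 : 0 < r by rewrite lt_min invr_gt0 ltr0n /= !divr_gt0.
have r2 : r <= 2^-1 by rewrite ge_min lexx.
have rD : r ^+ 2 * D <= e' / 2.
  have : r <= e' / 2 / (D + 1) by rewrite ge_min lexx orbT.
  rewrite ler_pdivlMr // => h; apply: le_trans h.
  rewrite expr2 -mulrA ler_wpM2l ?(ltW r0) //.
  apply: (@le_trans _ _ D); last by rewrite lerDl.
  by rewrite ler_piMl // (le_trans r2) // invf_le1 // ler1n.
have r1 : r <= 1 by apply: le_trans r2 _; rewrite invf_le1 // ler1n.
have [|S S0 /ccvgP hS] := hq _ (fun j => r * t j) c.
  move=> j; have /andP[tj0 tj1] := t01 j.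
  by rewrite mulr_ge0 ?(ltW r0) //= mulr_ile1 // ltW.
pose rho := r ^+ l0.*2.
have rho0 : 0 < rho by rewrite exprn_gt0.
have rhoC : rho%:C != 0 :> C by rewrite eq_complex /= eqxx andbT gt_eqF.
have [|N hN] := hS (rho * (e' / 2))%:C.
  by rewrite (ltcR 0) mulr_gt0 // divr_gt0.
exists (S / rho%:C); first by rewrite divr_ge0 // ler0c ltW.
have {hN} := hN (l0.+1 + N)%N (leq_addl _ _).
have mr l : \sum_j c j * (r * t j) ^+ l = r ^+ l * m l.
  by rewrite mulr_sumr; apply: eq_bigr => j _; rewrite exprMn mulrCA.
(* The terms below [l0] vanish, the term [l0] is [rho * q l0], and the tail is named [T] below. *)
rewrite big_split_ord /= big_ord_recr big1 /= => [|i _]; last first.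
  rewrite mr /m mom; last by rewrite ltnW // ltnS.
  by rewrite /= (ltn_eqF (ltn_ord i)) mulr0 expr0n mul0r.
rewrite mr {1}/m mom ?ltnSn // eqxx mulr1 add0r -exprM muln2 -/rho.
set T := \sum_(i < N) _ => hT.
have TD : `|T| <= (rho * (e' / 2))%:C.
  apply: le_trans (ler_norm_sum _ _ _) _.
  apply: (@le_trans _ _ (\sum_(k < N) (rho * r ^+ 2 * Mc ^+ 2 * Q * 2^-1 ^+ k)%:C)).
    apply: ler_sum => k _; rewrite mr normrM.
    apply: (@le_trans _ _ ((rho * r ^+ 2 * Mc ^+ 2 * 2^-1 ^+ k)%:C * Q%:C)); last first.
      by rewrite -rmorphM lecR mulrAC.
    apply: ler_pM => //; rewrite ger0_norm ?ler0c ?sqr_ge0 // lecR exprMn.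
    have -> : (r ^+ (l0.+1 + k)) ^+ 2 = rho * r ^+ 2 * (r ^+ k) ^+ 2.
      by rewrite -!exprM /rho -!exprD; congr (r ^+ _); clear; lia.
    rewrite -[leRHS]mulrA -[leLHS]mulrA [Mc ^+ 2 * _]mulrC.
    apply: ler_wpM2l; first exact: mulr_ge0 (ltW rho0) (sqr_ge0 r).
    apply: ler_pM; rewrite ?sqr_ge0 //; last first.
      by rewrite -real_normK ?num_real // ler_sqr ?nnegrE.
    have rk0 : 0 <= r ^+ k by rewrite exprn_ge0 // ltW.
    apply: (@le_trans _ _ (r ^+ k)).
      by rewrite expr2 ler_piMr // exprn_ile1 // ltW.
    by rewrite lerXn2r ?nnegrE ?invr_ge0 // ltW.
  rewrite -rmorph_sum lecR -mulr_sumr.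
  apply: (@le_trans _ _ (rho * (r ^+ 2 * D))); last by rewrite ler_pM2l.
  rewrite (_ : rho * (r ^+ 2 * D) = rho * r ^+ 2 * Mc ^+ 2 * Q * 2); last by rewrite /D; ring.
  by rewrite ler_wpM2l ?sum_half_le // !mulr_ge0 ?sqr_ge0 // ltW.
rewrite -(ler_pM2l (_ : 0 < rho%:C)) ?ltcR // -[X in X * _]ger0_norm ?ler0c ?(ltW rho0) //.
rewrite -normrM mulrBr mulrCA divff // mulr1.
rewrite (_ : S - _ = T - (rho%:C * q l0 + T - S)); last by ring.
apply: le_trans (ler_normB _ _) _; apply: le_trans (lerD TD (ltW hT)) _.
by rewrite ee' -rmorphD -rmorphM lecR; lra.
Qed.
End HomogeneousComponent.

(** * Kernels given by homogeneous expansions *)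

Section Moments.
Local Open Scope ring_scope.
Variables (C : comNzRingType) (n : nat) (I : finType) (t c : I -> C).
Hypothesis mom : forall m, (m < n)%N -> \sum_j c j * t j ^+ m = (m == 1%N)%:R.

Lemma sum_bin_at1 (p : nat) (F : nat -> C) : (forall m, (m <= p)%N -> F m = (m == 1%N)%:R) ->
  \sum_(m < p.+1) F m *+ 'C(p, m) = p%:R.
Proof.
case: p => [|p] hF; first by rewrite big_ord1 hF // mul0rn.
rewrite (bigD1 (lift ord0 ord0)) //= hF // eqxx bin1 big1 ?addr0 // => m m1.
have mp : (m <= p.+1)%N by have := ltn_ord m; rewrite ltnS.
rewrite hF //; case: eqP => [mE|_]; last by rewrite mul0rn.
by case/eqP: m1; apply: val_inj; rewrite /= mE.
Qed.

(** By [mom] the weights take the derivative at 0 of any polynomial in [t] of degree below [n], here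
    of [(1 + t)^p]. *)
Lemma moment_add1 p : (p < n)%N -> \sum_j c j * (1 + t j) ^+ p = p%:R.
Proof.
move=> pn; rewrite -[RHS](sum_bin_at1 (F := fun m => \sum_j c j * t j ^+ m)); last first.
  by move=> m mp; apply: mom; apply: leq_ltn_trans pn.
under [RHS]eq_bigr do rewrite -sumrMnl.
rewrite exchange_big; apply: eq_bigr => j _; rewrite exprDn mulr_sumr.
by apply: eq_bigr => m _; rewrite expr1n mul1r mulrnAr.
Qed.

(** The derivative functional is applied in both variables: each power of [t j * t k] yields the
    square of a moment, which is 0 or 1. *)
Lemma moment2_expand e p : (e + p < n)%N ->
  \sum_j \sum_k c j * c k * ((t j * t k) ^+ e * (1 + t j * t k) ^+ p)
    = \sum_(m < p.+1) ((m + e)%N == 1%N)%:R *+ 'C(p, m).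
Proof.
move=> epn.
transitivity (\sum_(m < p.+1) ((\sum_j c j * t j ^+ (m + e)) ^+ 2 *+ 'C(p, m))); last first.
  apply: eq_bigr => m _; rewrite mom; first by case: eqP; rewrite ?expr1n ?expr0n.
  by rewrite addnC (leq_trans _ epn) // ltnS leq_add2l -ltnS.
under [RHS]eq_bigr do rewrite expr2 mulr_suml -sumrMnl.
rewrite [RHS]exchange_big; apply: eq_bigr => j _.
under [RHS]eq_bigr do rewrite mulr_sumr -sumrMnl.
rewrite [RHS]exchange_big; apply: eq_bigr => k _.
rewrite exprDn !mulr_sumr; apply: eq_bigr => m _.
rewrite expr1n mul1r !mulrnAr -exprD [(e + m)%N]addnC exprMn.
by congr (_ *+ _); ring.
Qed.

Lemma moment2_add1 p : (p < n)%N ->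
  \sum_j \sum_k c j * c k * (1 + t j * t k) ^+ p = p%:R.
Proof.
move=> pn; have := @moment2_expand 0 p pn.
under eq_bigr do under eq_bigr do rewrite expr0 mul1r.
move=> ->; apply: (sum_bin_at1 (F := fun m => ((m + 0)%N == 1%N)%:R)).
by move=> m _; rewrite addn0.
Qed.

Lemma moment2_mul_add1 p : (p.+1 < n)%N ->
  \sum_j \sum_k c j * c k * ((t j * t k) * (1 + t j * t k) ^+ p) = 1.
Proof.
move=> pn; have := @moment2_expand 1 p pn.
under eq_bigr do under eq_bigr do rewrite expr1.
move=> ->; rewrite big_ord_recl /= bin0 mulr1n big1 ?addr0 // => m _.
by rewrite addn1 mul0rn.
Qed.

End Moments.

Section Spectrum.
Local Open Scope ring_scope.
Variables (R : realType) (d : nat).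
Local Notation C := R[i].
Local Notation V := 'cV[C]_d.

Lemma cinner_homk_scale (a b : C) l (x y x' y' : R) (z w u v : V) : (l = 0%N -> a = 0) ->
  cinner (homk a b l (x%:C *: z) (y%:C *: w) *m (y'%:C *: v)) (x'%:C *: u)
    = (x' * x ^+ l * (y' * y ^+ l))%:C * cinner (homk a b l z w *m v) u.
Proof.
move=> a0; rewrite !cinner_homk !cinnerZl !cinnerZr !conj_realC.
rewrite !rmorphM /= !rmorphXn /=.
case: l a0 => [->//|n _] /=; rewrite ?expr0 ?exprS ?exprMn; ring.
Qed.

(** Replacing each point by copies scaled by [t j] with weights [c j] factors the form by
    homogeneity, in the shape that [power_series_extract] needs. *)
Lemma qform_homk_scale (a b : C) l (I J : finType) (t c : J -> R) (pts vs : I -> V) :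
    (l = 0%N -> a = 0) ->
  qform (homk a b l) (fun p : J * I => (t p.1)%:C *: pts p.2)
      (fun p => (c p.1)%:C *: vs p.2)
    = ((\sum_j c j * t j ^+ l) ^+ 2)%:C * qform (homk a b l) pts vs.
Proof.
move=> a0; rewrite /qform.
transitivity (\sum_(p : J * I) \sum_(p' : J * I)
   (c p.1 * t p.1 ^+ l * (c p'.1 * t p'.1 ^+ l))%:C *
   cinner (homk a b l (pts p.2) (pts p'.2) *m vs p'.2) (vs p.2)).
  by apply: eq_bigr => p _; apply: eq_bigr => p' _; rewrite cinner_homk_scale.
rewrite -(pair_bigA _ (fun j k => \sum_(p' : J * I)
   (c j * t j ^+ l * (c p'.1 * t p'.1 ^+ l))%:C *
   cinner (homk a b l (pts k) (pts p'.2) *m vs p'.2) (vs k))) /=.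
rewrite expr2 mulr_suml rmorph_sum mulr_suml; apply: eq_bigr => j _ /=.
rewrite mulr_sumr; apply: eq_bigr => k _.
rewrite -(pair_bigA _ (fun j' m => (c j * t j ^+ l * (c j' * t j' ^+ l))%:C *
   cinner (homk a b l (pts k) (pts m) *m vs m) (vs k))) /=.
rewrite [c j * t j ^+ l * _]mulr_sumr rmorph_sum mulr_suml; apply: eq_bigr => j' _ /=.
by rewrite mulr_sumr.
Qed.

Lemma inBall_scale (x : R) (z : V) : 0 <= x <= 1 -> inBall z -> inBall (x%:C *: z).
Proof.
move=> /andP[x0 x1]; rewrite /inBall cinnerZl cinnerZr conj_realC mulrA -rmorphM.
apply: le_lt_trans; rewrite ler_piMl ?cinner_ge0 //.
by rewrite -[1]/(1%:C) lecR mulr_ile1.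
Qed.

Section Expansion.
Variables (a b : nat -> C) (K : V -> V -> 'M[C]_d).
Hypothesis a0 : a 0%N = 0.
Hypothesis KE : forall z w, inBall z -> inBall w ->
  mxseries_to (fun l => homk (a l) (b l) l z w) (K z w).

Lemma qform_cvg (I : finType) (pts vs : I -> V) : (forall k, inBall (pts k)) ->
  ccvg (fun N => \sum_(l < N) qform (homk (a l) (b l) l) pts vs) (qform K pts vs).
Proof.
move=> bp; apply: (@ccvg_ext _ (fun N => \sum_k \sum_m
    \sum_(l < N) cinner (homk (a l) (b l) l (pts k) (pts m) *m vs m) (vs k))).
  move=> N; rewrite /qform; under eq_bigr do rewrite exchange_big.
  by rewrite exchange_big.
apply: ccvg_sum => k _; apply: ccvg_sum => m _.
rewrite /cinner; apply: (@ccvg_ext _ (fun N => \sum_i \sum_j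
    (vs m j 0 * (vs k i 0)^*) * \sum_(l < N) homk (a l) (b l) l (pts k) (pts m) i j)).
  move=> N; rewrite [RHS]exchange_big; apply: eq_bigr => i _.
  under [RHS]eq_bigr do rewrite mxE mulr_suml.
  rewrite [RHS]exchange_big; apply: eq_bigr => j _; rewrite mulr_sumr.
  by apply: eq_bigr => l _; rewrite mulrC mulrA.
apply: ccvg_sum => i _; rewrite mxE mulr_suml; apply: ccvg_sum => j _.
rewrite -mulrA [K _ _ _ _ * _]mulrC; apply: ccvgM; exact: KE.
Qed.

Lemma nonneg_kernel_homk l (I : finType) (pts vs : I -> V) : nonneg_kernel K ->
  (forall k, inBall (pts k)) -> 0 <= qform (homk (a l) (b l) l) pts vs.
Proof.
move=> K0 bp; move: l; apply: power_series_extract => n t c t01.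
have bp' (p : 'I_n * I) : inBall ((t p.1)%:C *: pts p.2) by apply: inBall_scale.
exists (qform K (fun p : 'I_n * I => (t p.1)%:C *: pts p.2) (fun p => (c p.1)%:C *: vs p.2)).
  exact: nonneg_kernel_qform.
apply: ccvg_ext (qform_cvg _ bp') => N; apply: eq_bigr => l _.
by rewrite qform_homk_scale // => ->.
Qed.
End Expansion.
End Spectrum.

(** * The eigenvalue criterion *)

Section Coefficients.
Local Open Scope ring_scope.
Variables (R : realType) (d : nat).
Local Notation C := R[i].
Local Notation V := 'cV[C]_d.

Lemma cinner_delta_delta (i j : 'I_d) :
  cinner (delta_mx i 0 : V) (delta_mx j 0) = (i == j)%:R.
Proof. by rewrite cinner_delta mxE andbT eq_sym. Qed.

Section Test.
Variables (a b : C) (l : nat).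
Hypothesis a0 : l = 0%N -> a = 0.
Hypothesis q0 : forall (I : finType) (pts vs : I -> V), (forall k, inBall (pts k)) ->
  0 <= qform (homk a b l) pts vs.

(** One point along [i0] and a vector along [i1]: their orthogonality kills the [a] term. The factor
    1/2 keeps the point in the ball. *)
Lemma homk_test_b (i0 i1 : 'I_d) : i0 != i1 -> 0 <= b.
Proof.
move=> i01; pose z : V := (2^-1)%:C *: delta_mx i0 0.
have zz : cinner z z = (2^-1 * 2^-1)%:C.
  by rewrite cinnerZl cinnerZr conj_realC cinner_delta_delta eqxx mulr1 -rmorphM.
have := @q0 'I_1 (fun=> z) (fun=> delta_mx i1 0).
rewrite /qform !big_ord1 cinner_homk [cinner (delta_mx i1 0) z]cinnerZr.
rewrite !cinner_delta_delta eqxx eq_sym (negbTE i01) !mulr0 mul0r mulr0 mulr0 add0r mulr1 zz.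
rewrite pmulr_lge0; first apply.
  by move=> _; rewrite /inBall zz (ltcR _ 1); lra.
by rewrite exprn_gt0 // (ltcR 0); lra.
Qed.

(* Pairing the kernel function at [delta i0 + t * delta i] with [delta i] and taking
   the coefficient of [t], summed over [i], is the functional
   [h |-> div h (delta i0)]: it vanishes on the divergence free part. *)
Lemma homk_test_a (i0 : 'I_d) n : l = n.+1 -> 0 <= (n + d)%:R * a + n.+1%:R * b.
Proof.
(* The polynomials met below have degree at most [n.+1] in each node variable, so [n.+2] nodes
   suffice for the derivative at 0. *)
move=> ln; have [t [c [t01 momR]]] := interpolation_weights R (lift ord0 ord0 : 'I_n.+2).
pose tau j : C := (t j)%:C; pose gam j : C := (c j)%:C.
have mom m : (m < n.+2)%N -> \sum_j gam j * tau j ^+ m = (m == 1%N)%:R.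
  move=> mn; transitivity ((\sum_j c j * t j ^+ m)%:C); last by rewrite momR // rmorph_nat.
  by rewrite rmorph_sum; apply: eq_bigr => j _; rewrite rmorphM rmorphXn.
have tauJ j : (tau j)^* = tau j by exact: conj_realC.
pose z (p : 'I_d * 'I_n.+2) : V := delta_mx i0 0 + tau p.2 *: delta_mx p.1 0.
pose X (p p' : 'I_d * 'I_n.+2) : C := 1 + tau p.2 * (p.1 == i0)%:R
   + tau p'.2 * (p'.1 == i0)%:R + tau p.2 * tau p'.2 * (p.1 == p'.1)%:R.
have zX p p' : cinner (z p) (z p') = X p p'.
  rewrite /z /X !cinnerDl !cinnerDr !cinnerZl !cinnerZr !cinner_delta_delta eqxx.
  rewrite [i0 == _]eq_sym mulr1n tauJ; move: (_ == _)%:R (_ == _)%:R (_ == _)%:R => x y u.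
  by ring.
have zd p : cinner (z p) (delta_mx p.1 0) = (p.1 == i0)%:R + tau p.2.
  by rewrite cinnerDl cinnerZl !cinner_delta_delta eqxx mulr1 eq_sym.
have dz p : cinner (delta_mx p.1 0) (z p) = (p.1 == i0)%:R + tau p.2.
  by rewrite cinnerDr cinnerZr !cinner_delta_delta eqxx mulr1 tauJ.
(* The vectors [z p] have norm at most 2. *)
have ball p : inBall ((3^-1)%:C *: z p).
  rewrite /inBall cinnerZl cinnerZr conj_realC zX /X eqxx /tau.
  have /andP[tp0 tp1] := t01 p.2; move: (t p.2) tp0 tp1 => x x0 x1.
  rewrite (_ : _ * _ = (3^-1 * (3^-1 * (1 + x * (p.1 == i0)%:R + x * (p.1 == i0)%:R + x * x)))%:C).
    by rewrite (ltcR _ 1); case: (p.1 == i0); rewrite ?mulr1n ?mulr0n; nra.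
  by rewrite mulr1 !rmorphM !rmorphD !rmorphM rmorph1 rmorph_nat.
have := @q0 _ _ (fun p => gam p.2 *: delta_mx p.1 0) ball.
(* [e i] is the derivative at 0 of [(1 + t)^(n+1)] if [i = i0] and of [t] otherwise; these add up to
   [n + d]. *)
pose e (i : 'I_d) : C := if i == i0 then n.+1%:R else 1.
pose Y (p p' : 'I_d * 'I_n.+2) : C := gam p.2 * gam p'.2 *
  (a * (X p p' ^+ n * (((p'.1 == i0)%:R + tau p'.2) * ((p.1 == i0)%:R + tau p.2)))
   + b * (X p p' ^+ n.+1 * (p'.1 == p.1)%:R)).
have U : \sum_j gam j * (1 + tau j) ^+ n.+1 = n.+1%:R := moment_add1 mom (ltnSn _).
have T1 : \sum_j gam j * tau j = 1.
  by rewrite -[RHS](mom 1%N isT); apply: eq_bigr => j _; rewrite expr1.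
have W0 := moment2_add1 mom (ltnSn n.+1).
have W1 := moment2_mul_add1 mom (ltnSn n.+1).
(* In the cases below [X] is [(1 + tau j) (1 + tau k)], [1 + tau j], [1 + tau k], [1 + tau j tau k]
   and [1] respectively. *)
have YE i i' : \sum_j \sum_k Y (i, j) (i', k) = a * e i * e i' + (i == i')%:R * (b * n.+1%:R * e i).
  rewrite /e; case: (eqVneq i i0) => [->|ii0]; case: (eqVneq i' i0) => [->|i'i0].
  - transitivity ((a + b) * ((\sum_j gam j * (1 + tau j) ^+ n.+1) *
      (\sum_j gam j * (1 + tau j) ^+ n.+1))); last by rewrite U mulr1n; ring.
    rewrite big_distrlr mulr_sumr; apply: eq_bigr => j _.
    rewrite mulr_sumr; apply: eq_bigr => k _; rewrite /Y /X /= eqxx mulr1n.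
    rewrite (_ : 1 + _ + _ + _ = (1 + tau j) * (1 + tau k)); last by ring.
    rewrite !exprS !exprMn; move: ((1 + tau j) ^+ n) ((1 + tau k) ^+ n) => x y; ring.
  - transitivity (a * ((\sum_j gam j * (1 + tau j) ^+ n.+1) * (\sum_j gam j * tau j))); last first.
      by rewrite U T1 mulr0n; ring.
    rewrite big_distrlr mulr_sumr; apply: eq_bigr => j _.
    rewrite mulr_sumr; apply: eq_bigr => k _.
    rewrite /Y /X /= !eqxx ?[i0 == i']eq_sym ?(negbTE i'i0) mulr1n mulr0n.
    rewrite !mulr0 !addr0 mulr1 add0r !exprS; move: ((1 + tau j) ^+ n) => x; ring.
  - transitivity (a * ((\sum_j gam j * tau j) * (\sum_j gam j * (1 + tau j) ^+ n.+1))); last first.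
      by rewrite U T1 ?(negbTE ii0) mulr0n; ring.
    rewrite big_distrlr mulr_sumr; apply: eq_bigr => j _.
    rewrite mulr_sumr; apply: eq_bigr => k _.
    rewrite /Y /X /= eqxx [i0 == i]eq_sym (negbTE ii0) mulr1n mulr0n.
    rewrite !mulr0 !addr0 mulr1 add0r !exprS; move: ((1 + tau k) ^+ n) => x; ring.
  - case: (eqVneq i i') => [<-|ii'].
      transitivity (a * (\sum_j \sum_k gam j * gam k * (tau j * tau k * (1 + tau j * tau k) ^+ n))
          + b * (\sum_j \sum_k gam j * gam k * (1 + tau j * tau k) ^+ n.+1)); last first.
        by rewrite W0 W1 mulr1n; ring.
      rewrite !mulr_sumr -big_split; apply: eq_bigr => j _ /=.
      rewrite !mulr_sumr -big_split; apply: eq_bigr => k _ /=.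
      rewrite /Y /X /= eqxx (negbTE ii0) mulr1n mulr0n !mulr0 !addr0 !mulr1 !add0r !exprS.
      move: ((1 + tau j * tau k) ^+ n) => x; ring.
    transitivity (a * ((\sum_j gam j * tau j) * (\sum_j gam j * tau j))); last first.
      by rewrite T1 mulr0n; ring.
    rewrite big_distrlr mulr_sumr; apply: eq_bigr => j _.
    rewrite mulr_sumr; apply: eq_bigr => k _.
    rewrite /Y /X /= [i' == i]eq_sym (negbTE ii') (negbTE ii0) (negbTE i'i0) !mulr0n.
    rewrite !mulr0 !addr0 !expr1n; ring.
have d0 : (0 < d)%N by apply: leq_ltn_trans (ltn_ord i0).
have sume : \sum_i e i = (n + d)%:R.
  rewrite (bigD1 i0) //= {1}/e eqxx (eq_bigr (fun=> 1)) => [|i /negbTE ii0]; last first.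
    by rewrite /e ii0.
  rewrite sumr_const cardC1 card_ord -natrD; congr _%:R.
  by rewrite addSnnS prednK.
rewrite (_ : qform _ _ _ = ((3^-1 * 3^-1) ^+ l)%:C *
   ((n + d)%:R * ((n + d)%:R * a + n.+1%:R * b))); last first.
  transitivity (((3^-1 * 3^-1) ^+ l)%:C * \sum_p \sum_p' Y p p').
    rewrite /qform mulr_sumr; apply: eq_bigr => p _; rewrite mulr_sumr.
    apply: eq_bigr => p' _; rewrite cinner_homk_scale // cinner_homk zd dz zX ln.
    rewrite cinner_delta_delta /Y /gam exprMn !rmorphM; ring.
  congr (_ * _).
  rewrite -(pair_bigA _ (fun i j => \sum_p' Y (i, j) p')) /=.
  transitivity (\sum_i \sum_i' (a * e i * e i' + (i == i')%:R * (b * n.+1%:R * e i))).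
    apply: eq_bigr => i _.
    under eq_bigr do rewrite -(pair_bigA _ (fun i' k => Y (i, _) (i', k))) /=.
    rewrite exchange_big; apply: eq_bigr => i' _; exact: YE.
  rewrite (eq_bigr (fun i => (a * (\sum_i e i) + b * n.+1%:R) * e i)) => [|i _].
    by rewrite -mulr_sumr sume; ring.
  rewrite big_split -mulr_sumr /= [X in _ + X](bigD1 i) //= eqxx.
  rewrite [X in _ + (_ + X)]big1 => [|i' /negbTE ii']; last by rewrite eq_sym ii' mul0r.
  by rewrite mulr1n; ring.
rewrite pmulr_rge0; last by rewrite (ltcR 0) exprn_gt0 // mulr_gt0 // invr_gt0 ltr0n.
by rewrite pmulr_rge0 // ltr0n addn_gt0 d0 orbT.
Qed.
End Test.

(** Necessity isolates each degree and applies the two tests; sufficiency adds non-negative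
    components and passes to the limit. *)
Lemma nonneg_kernel_homkP (a b : nat -> C) (K : V -> V -> 'M[C]_d) (i0 i1 : 'I_d) :
    i0 != i1 -> a 0%N = 0 ->
    (forall z w, inBall z -> inBall w ->
      mxseries_to (fun l => homk (a l) (b l) l z w) (K z w)) ->
  nonneg_kernel K <->
    (forall l, 0 <= b l) /\ (forall n, 0 <= (n + d)%:R * a n.+1 + n.+1%:R * b n.+1).
Proof.
move=> i01 a0 KE; split=> [K0|[b0 ab] n pts vs bp].
  have H l : l = 0%N -> a l = 0 by move->.
  have q0 l (I : finType) (pts vs : I -> V) := @nonneg_kernel_homk _ _ a b K a0 KE l I pts vs K0.
  split=> [l|n]; first exact: (homk_test_b (q0 l) i01).
  exact: (homk_test_a (H n.+1) (q0 n.+1) i0 erefl).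
apply: ccvg_ge0 (qform_cvg KE vs bp) _ => N; apply: sumr_ge0 => l _.
by apply: qform_homk_ge0 => // [->//|m ->].
Qed.
End Coefficients.

(** * Expansions of [K] and of its shift by [c], and the boundedness criterion *)

Section Main.
Local Open Scope ring_scope.
Variables (R : realType) (d : nat) (a1 a2 : nat -> R[i]).
Variable K : 'cV[R[i]]_d -> 'cV[R[i]]_d -> 'M[R[i]]_d.
Hypothesis KE : forall z w : 'cV[R[i]]_d, inBall z -> inBall w ->
     exists K1 K2 : 'M[R[i]]_d,
       mxseries_to (kterm1 a1 a2 z w) K1 /\ mxseries_to (kterm2 a2 z w) K2 /\
       K z w = K1 + K2.

Definition coef1 (l : nat) : R[i] := if l is 0 then 0 else a1 l - a2 l.

Lemma kernel_homk_series z w : inBall z -> inBall w ->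
  mxseries_to (fun l => homk (coef1 l) (a2 l) l z w) (K z w).
Proof.
move=> bz bw; have [K1 [K2 [h1 [h2 ->]]]] := KE bz bw => i j.
have h1' : ccvg (fun N => \sum_(l < N) ((coef1 l * cinner z w ^+ l.-1) *: zwdag z w) i j) (K1 i j).
  (* [kterm1] at [l] has degree [l.+1], so its partial sums are shifted by one against those of
     [homk]. *)
  apply: ccvg_unshift; apply: ccvg_ext (h1 i j) => N.
  by rewrite big_ord_recl mul0r scale0r [X in X + _]mxE add0r.
rewrite mxE; apply: ccvg_ext (ccvgD h1' (h2 i j)) => N.
by rewrite -big_split; apply: eq_bigr => l _; rewrite [RHS]mxE.
Qed.

Variable c : R.

(** Multiplication by [cinner z w] moves the part of degree [n] to degree [n.+1]. *)
Definition shift1 (l : nat) : R[i] :=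
  if l is n.+1 then c%:C * coef1 l - coef1 n else 0.
Definition shift2 (l : nat) : R[i] :=
  if l is n.+1 then c%:C * a2 l - a2 n else c%:C * a2 0%N.

Lemma shifted_homk_series z w : inBall z -> inBall w ->
  mxseries_to (fun l => homk (shift1 l) (shift2 l) l z w) ((c%:C - cinner z w) *: K z w).
Proof.
move=> bz bw i j; have h := kernel_homk_series bz bw i j.
apply: ccvg_unshift; rewrite mxE mulrBl -mulNr.
apply: ccvg_ext (ccvgD (ccvgM c%:C (ccvg_shift h)) (ccvgM (- cinner z w) h)) => N.
rewrite !big_ord_recl mulrDr !mulr_sumr -addrA -big_split; congr (_ + _).
  by rewrite !mxE /= mulrA !mul0r !add0r !expr0 !mulr1 mulrA.
apply: eq_bigr => l _; rewrite !mxE /= /bump /= add1n.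
case: (nat_of_ord l) => [|n] /=; rewrite ?expr0 ?expr1 ?exprS; ring.
Qed.

(** With [l = n.+1] this is [l] times the eigenvalue of the degree [l] part of [K] on the multiples
    of [z]. *)
Lemma denom1E n : (0 < d)%N ->
  denom1 d a1 a2 n.+1 = (n + d)%:R * coef1 n.+1 + n.+1%:R * a2 n.+1.
Proof.
case: d => // m _; rewrite /denom1 /= !subn1 addnS addSn addnS /= -addSn natrD; ring.
Qed.

Lemma shift_numE n : (0 < d)%N ->
  (n + d)%:R * shift1 n.+1 + n.+1%:R * shift2 n.+1
    = c%:C * denom1 d a1 a2 n.+1 - num1 d a1 a2 n.+1.
Proof.
move=> d0; suff -> : num1 d a1 a2 n.+1 = (n + d)%:R * coef1 n + n.+1%:R * a2 n.
  by rewrite denom1E // /shift1 /shift2; move: (coef1 n.+1) (coef1 n) => x y; ring.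
case: d d0 => // m _; rewrite /num1 /a1ext /= !subn1 addnS addSn addnS /=.
(* At [n = 0] the convention in [a1ext] agrees with [coef1 0 = 0]. *)
by case: n => [|n]; rewrite /= ?mulr0 -addSn natrD; ring.
Qed.

End Main.

Theorem theorem4p2 (R : realType) (d : nat) (a1 a2 : nat -> R[i])
    (K : 'cV[R[i]]_d -> 'cV[R[i]]_d -> 'M[R[i]]_d) :
  (2 <= d)%N ->
  nonneg_kernel K ->
  (forall z w : 'cV[R[i]]_d, inBall z -> inBall w ->
     exists K1 K2 : 'M[R[i]]_d,
       mxseries_to (kterm1 a1 a2 z w) K1 /\ mxseries_to (kterm2 a2 z w) K2 /\
       K z w = K1 + K2) ->
  (forall l : nat, (1 <= l)%N -> denom1 d a1 a2 l != 0 /\ a2 l != 0) ->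
  tuple_bounded K <->
  exists B : R, forall l : nat, (1 <= l)%N ->
    num1 d a1 a2 l / denom1 d a1 a2 l <= B%:C /\ a2 l.-1 / a2 l <= B%:C.
Proof.
move=> d2 K0 KE nz; have d0 : (0 < d)%N := ltnW d2.
pose i0 := Ordinal d0; pose i1 := Ordinal d2.
have i01 : i0 != i1 by [].
have [b0 ab0] := (nonneg_kernel_homkP i01 erefl (kernel_homk_series KE)).1 K0.
(* Positivity of [K] makes the denominators non-negative, and being nonzero they are positive, so
   the ratios can be cleared. *)
have den0 n : 0 < denom1 d a1 a2 n.+1.
  by rewrite lt_def (nz n.+1 isT).1 denom1E // ab0.
have a20 n : 0 < a2 n.+1 by rewrite lt_def (nz n.+1 isT).2 b0.
have shiftP c := nonneg_kernel_homkP i01 erefl (shifted_homk_series KE c).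
split=> [/(tuple_boundedP K0)[c /shiftP[h2 h1]]|[B hB]].
  exists c => -[//|n] _; split; rewrite ler_pdivrMr // -subr_ge0.
    by rewrite -shift_numE.
  exact: (h2 n.+1).
apply/(tuple_boundedP K0); exists B; apply/shiftP; split=> [[|n]|n].
(* Degree 0 requires [B * a2 0 >= 0]; [B >= 0] follows from [0 <= a2 0 <= B * a2 1] and
   [a2 1 > 0]. *)
- have := (hB 1%N isT).2; rewrite ler_pdivrMr // => h; rewrite /= mulr_ge0 //.
  by rewrite -(pmulr_lge0 _ (a20 0%N)) (le_trans _ h).
- by have := (hB n.+1 isT).2; rewrite ler_pdivrMr // -subr_ge0.
by have := (hB n.+1 isT).1; rewrite ler_pdivrMr // -subr_ge0 -shift_numE.
Qed.
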